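(* Let $F$ be a distribution function on $\mathbb{R}$ having an absolutely continuous density $f=\exp(-\varphi)$, let $\mu$ be the corresponding probability measure, and let $K_\mu(x,y)=F(x\wedge y)-F(x)F(y)$. (a) If $\varphi$ has derivative $\varphi'$ which satisfies $\varphi'=\varphi_1'-\varphi_2'$, where $\varphi_j'\in L_1(F)$ for $j=1,2$ and the $\varphi_j'$ are left-continuous and nondecreasing, then $$\int_{\mathbb{R}}K_\mu(x,y)\,d\varphi'(y)=f(x).\qquad( * )$$ (b) If $\varphi$ has derivative $\varphi'\in L_1(F)$ which is absolutely continuous, then $$\int_{\mathbb{R}}K_\mu(x,y)\,\varphi''(y)\,dy=f(x).\qquad( ** )$$ (c) In particular, if $f$ is log-concave and absolutely continuous, $f=\exp(-\varphi)$ with $\varphi$ convex, then $( * )$ holds. (d) If $f$ is log-concave and absolutely continuous, and $\varphi'$ is absolutely continuous, then $( ** )$ holds.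
   Context: $L_1(F)$ is the space of functions integrable with respect to the probability measure $\mu$ with distribution function $F(x)=\mu((-\infty,x])$. If $g=g_1-g_2$ with $g_1,g_2$ nondecreasing and left-continuous, $\int k\,dg=\int k\,dg_1-\int k\,dg_2$, where $dg_j$ is the Lebesgue–Stieltjes measure determined by $g_j$ (so $dg_j([a,b))=g_j(b)-g_j(a)$).
   Formalization: In (b) the integral in ( ** ) need not exist as a Lebesgue integral; (b) is proved for each x at which its positive and negative parts are not both infinite, and, if f may vanish (φ=+∞ there), assuming {f>0} is an interval. *)

(* Defs.v *)
From HB Require Import structures.
From mathcomp Require Import all_boot all_order all_algebra.
From mathcomp Require Import all_classical all_reals all_analysis.
From mathcomp Require Import measurable_realfun.

Set Implicit Arguments.
Unset Strict Implicit.
Unset Printing Implicit Defensive.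

Import Order.TTheory GRing.Theory Num.Theory.
Import numFieldNormedType.Exports.

Local Open Scope classical_set_scope.
Local Open Scope ring_scope.

(* A function on the real line is absolutely continuous when it is so on every
   compact interval; [D] is [setT] for the density, and the open interval
   {f > 0} for the derivative of - ln f, which may blow up at its endpoints. *)
Definition abs_cont (R : realType) (a b : R) (g : R -> R) : Prop :=
  forall e : R, 0 < e -> exists2 d : R, 0 < d &
    forall (n : nat) (u v : 'I_n -> R),
      (forall i, a <= u i /\ u i <= v i /\ v i <= b) ->
      trivIset [set: 'I_n] (fun i => `]u i, v i[%classic) ->
      \sum_(i < n) (v i - u i) < d ->
      \sum_(i < n) `|g (v i) - g (u i)| < e.

Definition loc_abs_cont (R : realType) (D : set R) (g : R -> R) : Prop :=
  forall a b : R, `[a, b]%classic `<=` D -> abs_cont a b g.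

Definition nondecreasing_on (R : realType) (D : set R) (g : R -> R) : Prop :=
  forall x y : R, D x -> D y -> x <= y -> g x <= g y.

Definition left_continuous_on (R : realType) (D : set R) (g : R -> R) : Prop :=
  forall x : R, D x -> g y @[y --> x^'-] --> g x.

(* A convex phi need not be differentiable: phi' is then its left derivative,
   the left-continuous version of the derivative. *)
Definition is_lderive (R : realType) (g : R -> R) (x l : R) : Prop :=
  h^-1 * (g (x + h) - g x) @[h --> 0^'-] --> l.

Definition lderive (R : realType) (g : R -> R) (x : R) : R :=
  lim (h^-1 * (g (x + h) - g x) @[h --> 0^'-]).

(* Convexity of an extended-real-valued function that never takes the value
   -oo; recall that 0 * +oo = 0. *)
Definition econvex (R : realType) (phi : R -> \bar R) : Prop :=
  forall (x y t : R), 0 <= t <= 1 ->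
    (phi (t * x + (1 - t) * y)%R <= t%:E * phi x + (1 - t)%:E * phi y)%E.

(* A density that is log-concave may have a bounded support, so f = exp(- phi)
   is read with phi = +oo where f = 0, and phi' only makes sense on {f > 0}. *)
Definition edom (R : realType) (phi : R -> \bar R) : set R :=
  [set x | (phi x < +oo)%E].

(* [nu] is the Lebesgue-Stieltjes measure of a function [g] that is
   nondecreasing and left-continuous on the open interval [D]; it is
   regarded as a measure on the line that does not charge the complement. *)
Definition is_stieltjes (R : realType) (D : set R) (g : R -> R)
    (nu : {measure set (measurableTypeR R) -> \bar R}) : Prop :=
  nu (~` D) = 0%E /\
  forall a b : R, D a -> D b -> a <= b -> nu `[a, b[%classic = (g b - g a)%:E.

Definition stieltjes (R : realType) (D : set R) (g : R -> R) :
    {measure set (measurableTypeR R) -> \bar R} :=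
  match pselect (exists nu, is_stieltjes D g nu) with
  | left ex_nu => projT1 (cid ex_nu)
  | right _ => mzero
  end.

(* The measure is the image of the Lebesgue measure on the convex hull of the
   range of [g] under the generalized inverse q t = sup {x | g x <= t}. *)
Lemma stieltjesP (R : realType) (D : set R) (g : R -> R) :
  open D -> is_interval D -> nondecreasing_on D g -> left_continuous_on D g ->
  is_stieltjes D g (stieltjes D g).
Proof.
move=> oD iD ndg lcg.
suff ex_nu : exists nu, is_stieltjes D g nu.
  rewrite /stieltjes; case: pselect => [h|//]; exact: (projT2 (cid h)).
pose S t := [set x | D x /\ g x <= t].
pose T := [set t | exists a b, [/\ D a, D b, g a <= t & t < g b]].
have iT : is_interval T.
  move=> s t [a [b [Da Db as_ sb]]] [c [d [Dc Dd ct td]]] z /andP[sz zt].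
  by exists a, d; split => //; [exact: le_trans sz|exact: le_lt_trans td].
have mT : measurable (T : set (measurableTypeR R)) by exact: is_interval_measurable.
pose q t := sup (S t).
have Sub t b : D b -> t < g b -> ubound (S t) b.
  move=> Db tb x [Dx gx]; rewrite leNgt; apply/negP => bx.
  by have := ndg _ _ Db Dx (ltW bx); rewrite leNgt (le_lt_trans gx).
have supS t : T t -> has_sup (S t).
  by move=> [a [b [Da Db ta tb]]]; split; [exists a|exists b; exact: Sub].
have qub t b : T t -> D b -> t < g b -> q t <= b.
  move=> Tt Db tb; apply: ge_sup; [by case: (supS _ Tt)|exact: Sub].
have qlb t a : T t -> D a -> g a <= t -> a <= q t.
  by move=> Tt Da ta; apply: ub_le_sup; [by case: (supS _ Tt)|split].
have left_near x (P : R -> Prop) : D x -> (\forall y \near x^'-, P y) ->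
    exists y, [/\ D y, y < x & P y].
  move=> Dx Px.
  have DN : \forall y \near x^'-, D y.
    by apply: cvg_within; apply: open_nbhs_nbhs.
  have H : \forall y \near x^'-, (D y /\ y < x) /\ P y.
    by apply: filterI Px; apply: filterI DN (nbhs_left_lt x).
  have [y [[? ?] ?]] : exists y, (D y /\ y < x) /\ P y by exact: (@filter_ex _ (x^'-) _ _ H).
  by exists y.
have qlt t b : T t -> D b -> (q t < b) = (t < g b).
  move=> Tt Db; apply/idP/idP => h.
    rewrite ltNge; apply/negP => /(qlb _ _ Tt Db).
    by rewrite leNgt h.
  have /(left_near b)[//|y [Dy yb ty]] : \forall y \near b^'-, t < g y.
    by exact: (cvgr_gt _ (lcg _ Db)).
  exact: le_lt_trans (qub _ _ Tt Dy ty) yb.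
have DTq t : T t -> D (q t).
  move=> Tt; have [a [b [Da Db ta tb]]] := Tt.
  by apply: (iD _ _ Da Db); rewrite qlb ?qub.
have mq : measurable_fun (T : set (measurableTypeR R))
    (q : measurableTypeR R -> measurableTypeR R).
  apply: (measurability (@RGenCInfty.G R)) => [|/= _ [_] [r] -> <-].
    exact: RGenCInfty.measurableE.
  apply: is_interval_measurable => s t /= [Ts +] [Tt +] z szt.
  have Tz : T z := iT _ _ Ts Tt _ szt.
  rewrite !in_itv/= !andbT => rs _; split => //; apply: (le_trans rs).
  apply: sup_le => //; [|by case: (supS _ Ts)|exact: supS].
  move=> x [Dx xs]; apply/downP; exists x => //; split => //.
  by rewrite (le_trans xs)//; case/andP: szt.
have [] := pselect (exists x, D x) => [[p Dp]|D0]; last first.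
  exists mzero; split => // a b Da; exfalso; apply: D0; by exists a.
pose q' := (q : measurableTypeR R -> measurableTypeR R) \_ T.
have mq' : measurable_fun [set: measurableTypeR R] q'.
  by apply/(measurable_restrictT _ mT).
pose m := mrestr (@lebesgue_measure R) mT.
pose nu : {measure set (measurableTypeR R) -> \bar R} :=
  measure_function_pushforward__canonical__measure_function_Measure m mq'.
exists nu; split.
  rewrite /nu /= /pushforward /m /mrestr (_ : _ `&` _ = set0) ?measure0//.
  apply/seteqP; split => // t [/= + Tt]; rewrite /q' patchE mem_set//.
  by move/(_ (DTq _ Tt)).
move=> a b Da Db ab; rewrite /nu /= /pushforward /m /mrestr.
rewrite (_ : _ `&` _ = `[g a, g b[%classic).
  rewrite lebesgue_measure_itv/= lte_fin; case: ltP => // gba.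
  have -> : g a = g b by apply/le_anti; rewrite gba ndg.
  by rewrite subrr.
apply/seteqP; split => t /=; rewrite !in_itv/=.
  move=> [+ Tt]; rewrite /q' patchE mem_set// => /andP[aq].
  by rewrite qlt// => ->; rewrite andbT leNgt -qlt// -leNgt.
move=> /andP[at_ tb]; have Tt : T t by exists a, b.
by rewrite /q' patchE mem_set// qlt// tb leNgt qlt// -leNgt at_.
Qed.

Definition has_density (R : realType) (mu : probability (measurableTypeR R) R)
    (f : R -> R) : Prop :=
  forall A : set (measurableTypeR R), measurable A ->
    mu A = (\int[lebesgue_measure]_(x in A) (f x)%:E)%E.

Definition distr_fun (R : realType) (mu : probability (measurableTypeR R) R)
    (x : R) : R := fine (mu `]-oo, x]%classic).

Definition Kmu (R : realType) (mu : probability (measurableTypeR R) R)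
    (x y : R) : R :=
  distr_fun mu (Num.min x y) - distr_fun mu x * distr_fun mu y.

(* The Lebesgue integral of [g] is not of the form +oo - +oo. *)
Definition has_integral (R : realType) (g : R -> \bar R) : Prop :=
  (\int[@lebesgue_measure R]_y g^\+ y < +oo)%E \/
  (\int[@lebesgue_measure R]_y g^\- y < +oo)%E.

(* Main.v *)
Require Import Defs.
From HB Require Import structures.
From mathcomp Require Import all_boot all_order all_algebra.
From mathcomp Require Import all_classical all_reals all_analysis.
From mathcomp Require Import measurable_realfun ring lra.

(* Write c(z) = 1{z <= x} - F(x), a function of mu-mean 0 and modulus at most 1,
   so that K_mu(x,y) = \int c(z) 1{z <= y} dmu(z).  Fubini's theorem on [a,b[
   gives \int_[a,b[ K_mu(x,y) dg(y) = - \int c(z) g(clamp(a,b,z)) dmu(z), where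
   clamp projects onto [a,b].  When [a,b[ exhausts {f > 0} the right-hand side
   tends to - \int c g dmu: by dominated convergence when g is monotone and in
   L_1(mu), and otherwise along endpoints at which g(b) (1 - F(b)) and g(a) F(a)
   tend to 0; such endpoints exist because g is in L_1(mu).  Finally
   f' = - phi' f gives f(z) = - \int_{t <= z} phi' dmu and \int phi' dmu = 0,
   whence - \int c phi' dmu = f(x).

   As phi' is only a left derivative, f' = - phi' f is integrated by a mean value
   inequality for left derivatives.  In (b) phi' is the integral of phi'' by the
   Radon-Nikodym theorem, applied to the variation of phi', and Lebesgue's
   differentiation theorem.  In (c) phi' is nondecreasing, and it is in L_1(mu)
   because \int_]p,b] (phi' - phi'(p)) dmu <= f(p) - f(b) + |phi'(p)|, and
   similarly to the left of p. *)

Set Implicit Arguments.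
Unset Strict Implicit.
Unset Printing Implicit Defensive.

Import Order.TTheory GRing.Theory Num.Theory.
Import numFieldNormedType.Exports.

Local Open Scope classical_set_scope.
Local Open Scope ring_scope.

(** * Left derivatives *)

Section left_derivative.
Context {R : realType}.
Implicit Types (g H : R -> R) (a b c l x y M e : R).

(** At the ends of D = {f > 0} the derivative phi' may blow up, so every identity is first obtained
    on compact subintervals of D. Integrating f' = - phi' f there only shows that f(z) + \int_{t <=
    z} phi' dmu is constant on D. As the integral vanishes at the left end, f tends to this constant
    there. A negative constant contradicts f >= 0; a positive one would keep f away from 0 near that
    end, so by continuity D would contain a half-line on which f is bounded below, against total
    mass 1. The same argument at the right end gives \int phi' dmu = 0.

    In (b) the function g = phi' is not monotone, so nothing dominates the constants g(a) and g(b)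
    that clamping puts on the tails. Their contributions are at most |g(a)| F(a) and |g(b)| (1 -
    F(b)). A Chebyshev argument finds endpoints where these are small: were |g| times the mass of a
    tail above e throughout the tail, the integral of |g| over it would be at least e. The sign of
    phi'' is unknown as well, so the positive and negative parts of the integrand pass to the limit
    separately. *)

Lemma is_lderive_le g x l e : 0 < e -> is_lderive g x l ->
  \forall h \near (0 : R)^'-, `|g (x + h) - g x - l * h| <= e * `|h|.
Proof.
move=> e0 /cvgrPdist_le /(_ _ e0) gl.
near=> h.
have h0 : h < 0 by near: h; exact: nbhs_left_lt.
have : `|l - h^-1 * (g (x + h) - g x)| <= e by near: h.
have -> : l - h^-1 * (g (x + h) - g x) = - h^-1 * (g (x + h) - g x - l * h).
  by field; exact: ltr0_neq0.
by rewrite normrM normrN normfV mulrC ler_pdivrMr// normr_gt0 lt_eqF.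
Unshelve. all: by end_near. Qed.

Lemma is_lderive_near g x l e : 0 < e -> is_lderive g x l ->
  \forall y \near x^'-, `|g x - g y - l * (x - y)| <= e * (x - y).
Proof.
move=> e0 /(is_lderive_le e0)[d /= d0 Hd]; exists d => //= y; rewrite /ball_ => yxd yx.
have := Hd (y - x); rewrite /= sub0r normrN [`|y - x|]distrC => /(_ yxd).
rewrite subr_lt0 => /(_ yx). rewrite (@gtr0_norm _ (x - y)) ?subr_gt0//.
have -> : x + (y - x) = y by ring.
have -> : g y - g x - l * (y - x) = - (g x - g y - l * (x - y)) by ring.
by rewrite normrN.
Qed.

(* From b, move down to the infimum of the points at which the bound holds. *)
Lemma left_mean_value H M a b : a <= b ->
  (forall x, a <= x < b -> H y @[y --> x^'+] --> H x) ->
  (forall x e, a < x <= b -> 0 < e ->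
    \forall y \near x^'-, H x - H y <= (M + e) * (x - y)) ->
  H b - H a <= M * (b - a).
Proof.
move=> ab rcH dH.
suff He e : 0 < e -> H b - H a <= (M + e) * (b - a).
  apply/ler_addgt0Pr => e e0; have e1 : 0 < e / (b - a + 1) by rewrite divr_gt0// ltr_wpDl// subr_ge0.
  apply: (le_trans (He _ e1)); rewrite mulrDl lerD2l -mulrAC ler_pdivrMr; last by lra.
  by nra.
move=> e0.
pose S := [set x | a <= x <= b /\ H b - H x <= (M + e) * (b - x)].
have Sb : S b by split; rewrite ?lexx ?ab// !subrr mulr0.
have infS : has_inf S by split; [exists b|exists a => x -[/andP[]]].
pose s := inf S.
have sb : s <= b by apply: ge_inf => //; exact: infS.2.
have as_ : a <= s by apply: lb_le_inf; [exists b|move=> x -[/andP[]]].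
(* The infimum lies in [S]: if the bound failed at [s], right continuity would make it fail just to
   the right of [s], where [S] has points. *)
have Ss : S s.
  have [->//|sb'] := eqVneq s b.
  split; first by rewrite as_.
  rewrite leNgt; apply/negP => Hs.
  have slb : s < b by rewrite lt_neqAle sb'.
  have lim : (H b - H y) - (M + e) * (b - y) @[y --> s^'+] -->
             (H b - H s) - (M + e) * (b - s).
    apply: cvgB.
      by apply: cvgB; [exact: cvg_cst|apply: rcH; rewrite as_].
    apply: cvgM; first exact: cvg_cst.
    apply: cvgB; first exact: cvg_cst.
    by apply: cvg_at_right_filter.
  have /(cvgr_gt _ lim) [d /= d0 Hd] : 0 < (H b - H s) - (M + e) * (b - s) by rewrite subr_gt0.
  have [y Sy ysd] := inf_adherent d0 infS.
  have sy : s <= y by apply: ge_inf => //; exact: infS.2.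
  have [sy'|sy'] := eqVneq s y.
    by case: Sy => _; rewrite -sy' leNgt Hs.
  have sltY : s < y by rewrite lt_neqAle sy'.
  have sy_d : `|s - y| < d by rewrite ltr0_norm ?subr_lt0// opprB ltrBlDl.
  have := Hd y sy_d sltY.
  by rewrite subr_gt0 ltNge; case: Sy => _ ->.
have [->|sa] := eqVneq a s; first by case: Ss.
have as' : a < s by rewrite lt_neqAle sa.
have /dH/(_ e0) Hs : a < s <= b by rewrite as'.
have [y [/andP[ay ys] Hy]] : exists y, (a < y < s) /\ H s - H y <= (M + e) * (s - y).
  have /filter_ex[y [? ?]] : \forall y \near s^'-, (a < y < s) /\ H s - H y <= (M + e) * (s - y).
    near=> y; split; last by near: y.
    apply/andP; split; near: y; [exact: nbhs_left_gt|exact: nbhs_left_lt].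
  by exists y.
have Sy : S y.
  split; first by rewrite (ltW ay)/= (le_trans (ltW ys)).
  case: Ss => _ Ss.
  by have := lerD Ss Hy; rewrite -mulrDr; lra.
have : s <= y by apply: ge_inf => //; exact: infS.2.
by rewrite leNgt ys.
Unshelve. all: by end_near. Qed.

End left_derivative.

Lemma le_normr_RintegralB_cst d (T : measurableType d) (R : realType)
    (m : {measure set T -> \bar R}) (A : set T) (g : T -> R) (L e : R) :
  measurable A -> (m A < +oo)%E -> m.-integrable A (EFin \o g) ->
  (forall t, A t -> `|g t - L| <= e) ->
  `|\int[m]_(t in A) g t - L * fine (m A)| <= e * fine (m A).
Proof.
move=> mA Afin ig gL.
have icst k : m.-integrable A (EFin \o cst k).
  apply/integrableP; split; first exact/measurable_EFinP/measurable_cst.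
  by rewrite /= integral_cst// lte_mul_pinfty.
rewrite -!Rintegral_cst// -RintegralB//; last exact: icst.
have igL : m.-integrable A (EFin \o (fun t => g t - L)).
  by rewrite (_ : _ \o _ = (EFin \o g) \- (EFin \o cst L))%E//;
    apply: integrableB => //; exact: icst.
apply: (le_trans (le_normr_Rintegral mA igL)).
apply: le_Rintegral => //; [exact: integrable_norm|exact: icst].
Qed.

(** * Integration of the left derivative of the density *)

Section density.
Context {R : realType} (mu : probability (measurableTypeR R) R) (f : R -> R).
Hypotheses (f_ge0 : forall x, 0 <= f x) (f_cont : continuous f)
  (f_density : has_density mu f).

Lemma density_integrable (A : set R) : measurable A ->
  lebesgue_measure.-integrable A (EFin \o f).
Proof.
move=> mA; apply/integrableP; split.
  apply/measurable_EFinP; apply: measurable_funTS.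
  exact: continuous_measurable_fun.
under eq_integral do rewrite /= ger0_norm//.
by rewrite -(f_density mA) (le_lt_trans (probability_le1 mu mA)) ?ltry.
Qed.

(** Continuity of [f] at [x], stated for intervals on either side of [x]: it serves the left
    derivative of integrals against [mu], their right continuity, and the positive mass of tails. *)
Lemma density_near x e : 0 < e -> exists2 d, 0 < d &
  forall u v, x - d < u -> u <= v -> v < x + d ->
  `|fine (mu `]u, v]%classic) - f x * (v - u)| <= e * (v - u).
Proof.
have fx : f t @[t --> x] --> f x by exact: f_cont.
move=> e0; have /cvgrPdist_le /(_ _ e0)[d /= d0 Hd] := fx.
exists d => // u v xdu; rewrite le_eqVlt => /predU1P[<- _|uv vxd].
  by rewrite set_itvoc0 measure0 subrr !mulr0 subrr normr0.
have luv : fine (lebesgue_measure `]u, v]%classic) = v - u :> R.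
  by rewrite lebesgue_measure_itv/= lte_fin uv.
have muv : measurable (`]u, v]%classic : set (measurableTypeR R)) by [].
rewrite (f_density muv) -luv.
apply: le_normr_RintegralB_cst => //; first 2 last.
- move=> t /=; rewrite in_itv/= => /andP[ut tv]; rewrite distrC; apply: Hd => /=.
  by rewrite ltr_norml; lra.
- by rewrite /= lebesgue_measure_itv/= lte_fin uv ltry.
- exact: density_integrable.
Qed.

(** Let G be the indefinite [mu]-integral of [psi]. Left continuity of [psi] gives G the left
    derivative [psi x * f x], so f + G has left derivative 0, and [left_mean_value] applied to it
    and to its opposite makes it constant. *)
Lemma left_FTC a b (psi : R -> R) : a <= b ->
  (forall x, a < x <= b -> is_lderive f x (- (psi x * f x))) ->
  (forall x, a < x <= b -> psi y @[y --> x^'-] --> psi x) ->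
  mu.-integrable `]a, b] (EFin \o psi) ->
  f b - f a = - (\int[mu]_(x in `]a, b]) psi x)%R.
Proof.
move=> ab df lcpsi ipsi.
have mI u v : measurable (`]u, v]%classic : set (measurableTypeR R)) by [].
have ipsiS u v : a <= u -> v <= b -> mu.-integrable `]u, v] (EFin \o psi).
  move=> au vb; apply: integrableS ipsi => // t /=.
  by rewrite !in_itv/= => /andP[ut tv]; rewrite (le_lt_trans au)//= (le_trans tv).
pose G x := (\int[mu]_(t in `]a, x]) psi t)%R.
pose H x := f x + G x.
have GB x y : a <= y -> y <= x -> x <= b -> G x - G y = (\int[mu]_(t in `]y, x]) psi t)%R.
  move=> ay yx xb; have axE : `]a, x]%classic = `]a, y]%classic `|` `]y, x]%classic.
    by rewrite -itv_bndbnd_setU// bnd_simp.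
  rewrite /G axE.
  rewrite Rintegral_setU//=; [by ring| |].
  - by rewrite -axE; exact: ipsiS.
  - apply/disj_setPLR => t /=; rewrite !in_itv/= => /andP[_ ty].
    by apply/negP; rewrite negb_and -leNgt ty.
have muS u v : (mu `]u, v]%classic < +oo)%E by rewrite (le_lt_trans (probability_le1 mu _)) ?ltry.
(* [left_mean_value] needs right continuity. It holds as the integral of |psi| over a set of small
   mass is small, and the mass of []x, y]] is at most (f x + 1) (y - x) for [y] close to [x]. *)
have Grc x : a <= x < b -> G y @[y --> x^'+] --> G x.
  move=> /andP[ax xb]; apply/cvgrPdist_lt => e e0.
  have ipsiT : mu.-integrable setT (EFin \o (psi \_ `]a, b])).
    by rewrite -restrict_EFin -integrable_mkcond.
  have [d [d0 Hd]] := integral_normr_continuous ipsiT e0.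
  have [r r0 Hr] := density_near x ltr01.
  near=> y.
  have xy : x < y by near: y; exact: nbhs_right_gt.
  have yb : y < b by near: y; exact: nbhs_right_lt.
  have yxr : y < x + r by near: y; apply: nbhs_right_lt; rewrite ltrDl.
  have yxd : y < x + d / (f x + 1).
    by near: y; apply: nbhs_right_lt; rewrite ltrDl divr_gt0// ltr_wpDl.
  rewrite distrC GB ?(ltW xy) ?(ltW yb)//.
  have ixy := ipsiS x y ax (ltW yb).
  apply: (le_lt_trans (le_normr_Rintegral _ ixy)) => //.
  have -> : (\int[mu]_(t in `]x, y]) `|psi t| = \int[mu]_(t in `]x, y]) `|(psi \_ `]a, b]) t|)%R.
    apply: eq_Rintegral => t; rewrite inE/= in_itv/= => /andP[xt ty].
    by rewrite patchE mem_set//= in_itv/= (le_lt_trans ax)//= (le_trans ty)// ltW.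
  apply: Hd => //.
  rewrite -[X in (X < _)%E]fineK ?fin_num_measure// lte_fin.
  have fx1 : 0 < f x + 1 by rewrite ltr_wpDl.
  have := Hr x y; rewrite ltrBlDr ltrDl => /(_ r0 (ltW xy) yxr).
  rewrite ler_norml mul1r => /andP[_ h].
  apply: (@le_lt_trans _ _ ((f x + 1) * (y - x))); first lra.
  by rewrite mulrC -ltr_pdivlMr//; lra.
suff : H b - H a = 0.
  rewrite /H /G set_itvoc0 Rintegral_set0; lra.
have dH x e : a < x <= b -> 0 < e -> \forall y \near x^'-, `|H x - H y| <= e * (x - y).
  move=> axb e0; have /andP[ax xb] := axb.
  pose p := `|psi x|; have p0 : 0 <= p by exact: normr_ge0.
  pose q := f x; have q0 : 0 <= q by exact: f_ge0.
  (* The increment of [H] is a sum of three errors, each at most e / 4 per unit length: that of the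
     left derivative of [f], that of [mu] against f x (x - y), weighted by |psi x|, and that of
     [psi] against [psi x], weighted by the mass of []y, x]]. This mass is at most (f x + 1) (x - y)
     because e2 <= 1. *)
  pose e1 := e / (4 * (q + 1)); pose e2 := Num.min 1 (e / (4 * (p + 1))).
  have e1_gt0 : 0 < e1 by rewrite divr_gt0// mulr_gt0// ltr_wpDl.
  have e2_gt0 : 0 < e2 by rewrite lt_min ltr01/= divr_gt0// mulr_gt0// ltr_wpDl.
  have e4 : 0 < e / 4 by rewrite divr_gt0.
  have e1q : e1 * (q + 1) = e / 4 by rewrite /e1; field; lra.
  have e2p : e2 * (p + 1) <= e / 4.
    apply: (@le_trans _ _ (e / (4 * (p + 1)) * (p + 1))).
      by rewrite ler_wpM2r ?addr_ge0// ge_min lexx orbT.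
    by rewrite le_eqVlt; apply/orP; left; apply/eqP; field; lra.
  have e21 : e2 <= 1 by rewrite ge_min lexx.
  have [r r0 Hr] := density_near x e2_gt0.
  have /cvgrPdist_le/(_ _ e1_gt0)[s /= s0 Hs] := lcpsi _ axb.
  near=> y.
  have yx : y < x by near: y; exact: nbhs_left_lt.
  have ay : a < y by near: y; exact: nbhs_left_gt.
  have xry : x - r < y by near: y; apply: nbhs_left_gt; rewrite ltrBlDr ltrDl.
  have xsy : x - s < y by near: y; apply: nbhs_left_gt; rewrite ltrBlDr ltrDl.
  have h1 : `|f x - f y - - (psi x * f x) * (x - y)| <= e / 4 * (x - y).
    by near: y; apply: is_lderive_near => //; exact: df.
  have h2 : `|fine (mu `]y, x]%classic) - q * (x - y)| <= e2 * (x - y).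
    by apply: Hr => //; rewrite ?ltrDl// ltW.
  have h3 : `|G x - G y - psi x * fine (mu `]y, x]%classic)| <= e1 * fine (mu `]y, x]%classic).
    rewrite GB ?(ltW ay) ?(ltW yx)//.
    apply: le_normr_RintegralB_cst => //; [exact: muS|exact: ipsiS (ltW ay) xb|].
    move=> t /=; rewrite in_itv/= le_eqVlt => /andP[yt /predU1P[->|tx]].
      by rewrite subrr normr0 ltW.
    by rewrite distrC; apply: Hs => //=; rewrite ltr_norml; lra.
  set m := fine _ in h2 h3.
  have -> : H x - H y = (f x - f y - - (psi x * f x) * (x - y)) +
     (psi x * (m - q * (x - y)) + (G x - G y - psi x * m)) by rewrite /H /q; ring.
  apply: (le_trans (ler_normD _ _)); apply: (le_trans (lerD h1 (ler_normD _ _))).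
  rewrite normrM -/p.
  have h4 := ler_wpM2l p0 h2.
  have yx0 : 0 <= x - y by lra.
  have h5 : m <= (q + 1) * (x - y).
    by move: h2; rewrite ler_norml => /andP[_ h2]; have := ler_wpM2r yx0 e21; lra.
  have h6 := ler_wpM2l (ltW e1_gt0) h5.
  have h7 := ler_wpM2r yx0 e2p.
  have h8 : 0 <= e2 * (x - y) by rewrite mulr_ge0// ltW.
  move: h6; rewrite mulrA e1q => h6.
  have h9 : 0 <= e * (x - y) by rewrite mulr_ge0// ltW.
  move: h1 h2 h3 h4 h5 h6 h7 h8 h9; nra.
have Hrc x : a <= x < b -> H y @[y --> x^'+] --> H x.
  move=> axb; apply: cvgD; last exact: Grc.
  by apply: cvg_at_right_filter; exact: f_cont.
apply/eqP; rewrite eq_le; apply/andP; split.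
  rewrite -(mul0r (b - a)); apply: left_mean_value => // x e axb e0.
  by rewrite add0r; apply: filterS (dH _ _ axb e0) => y; apply: le_trans; exact: ler_norm.
rewrite -oppr_le0 opprB -[X in _ <= X](mul0r (b - a)) -(opprK (H a)) addrC.
apply: (@left_mean_value _ (fun x => - H x)) => // [x axb|x e axb e0].
  by apply: cvgN; exact: Hrc.
rewrite add0r; apply: filterS (dH _ _ axb e0) => y; apply: le_trans.
by rewrite -opprD -normrN ler_norm.
Unshelve. all: by end_near. Qed.

End density.

(** * The interval where the density is positive *)

(** [Q n] is an extra requirement on the n-th term, such as a tail bound that improves with n. A
    first sequence [u] exhausts [D] to the right, along [sup D] or along the integers; each term of
    [e] is then picked beyond both its predecessor and the corresponding term of [u]. *)
Lemma open_cofinal_seq (R : realType) (D : set R) (Q : nat -> set R) :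
  open D -> D !=set0 ->
  (forall n b, D b -> exists2 z, D z & b <= z /\ Q n z) ->
  exists e : R^nat, [/\ {homo e : m n / (m <= n)%N >-> m <= n},
    forall n, D (e n), forall n, Q n (e n) & forall z, D z -> exists n, z < e n].
Proof.
move=> oD [p Dp] exQ.
have above z : D z -> exists2 y, D y & z < y.
  move=> Dz; have : \forall y \near z^'+, D y.
    by apply: cvg_within; exact: open_nbhs_nbhs.
  move=> Dn; near (z : R)^'+ => y; exists y; first by near: y.
  by near: y; exact: nbhs_right_gt.
have [u [Du uP]] : exists u : R^nat, (forall n, D (u n)) /\ forall z, D z -> exists n, z < u n.
  have [supD|nsupD] := pselect (has_ubound D).
    have hD : has_sup D by split => //; exists p.
    have exz n : exists z, D z /\ sup D - n.+1%:R^-1 < z.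
      have n0 : (0 : R) < n.+1%:R^-1 by rewrite invr_gt0.
      by have [z Dz hz] := sup_adherent n0 hD; exists z.
    have [u Hu] := choice exz; exists u; split; first by move=> n; case: (Hu n).
    move=> z Dz; have zs : z < sup D.
      by have [y Dy zy] := above _ Dz; apply: (lt_le_trans zy); exact: ub_le_sup.
    have [n hn] : exists n, n.+1%:R^-1 < sup D - z.
      have d0 : 0 < sup D - z by rewrite subr_gt0.
      have := near_infty_natSinv_lt (PosNum d0) => -[N _ /(_ N (leqnn N))] /= h.
      by exists N.
    by exists n; have [_] := Hu n; apply: le_lt_trans; rewrite lerBrDr -lerBrDl ltW.
  have exz (n : nat) : exists z, D z /\ n%:R < z.
    apply: contrapT => h; apply: nsupD; exists n%:R => z Dz.
    by rewrite leNgt; apply/negP => nz; apply: h; exists z.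
  have [u Hu] := choice exz; exists u; split; first by move=> n; case: (Hu n).
  move=> z _; exists (Num.truncn z).+1; have [_] := Hu (Num.truncn z).+1.
  by apply: lt_trans; exact: truncnS_gt.
(* Moving the hypothesis [D nb.2] under the existential makes the relation total, so that choice
   yields a function usable in a [fix]. *)
have exG nb : exists z, D nb.2 -> [/\ D z, nb.2 <= z & Q nb.1 z].
  have [Db|nDb] := pselect (D nb.2); last by exists 0.
  by have [z Dz [? ?]] := exQ nb.1 nb.2 Db; exists z.
have [G HG] := choice exG.
pose e := fix e n := if n is m.+1 then G (m.+1, Num.max (e m) (u m.+1)) else G (0%N, u 0%N).
have Dmax x y : D x -> D y -> D (Num.max x y) by rewrite /Num.max; case: ifP.
have De n : D (e n).
  elim: n => [|n IH] /=; first by case: (HG (0%N, u 0%N) (Du 0%N)).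
  by case: (HG (n.+1, Num.max (e n) (u n.+1)) (Dmax _ _ IH (Du _))).
have H1 n : Num.max (e n) (u n.+1) <= e n.+1.
  by case: (HG (n.+1, Num.max (e n) (u n.+1)) (Dmax _ _ (De n) (Du _))).
have ue n : u n <= e n.
  case: n => [|n]; first by case: (HG (0%N, u 0%N) (Du 0%N)).
  by apply: le_trans (H1 n); rewrite le_max lexx orbT.
exists e; split => //.
- apply: homo_leq => //; first exact: le_trans.
  by move=> n; apply: le_trans (H1 n); rewrite le_max lexx.
- move=> [|n]; first by case: (HG (0%N, u 0%N) (Du 0%N)).
  by case: (HG (n.+1, Num.max (e n) (u n.+1)) (Dmax _ _ (De n) (Du _))).
- by move=> z Dz; have [n zu] := uP z Dz; exists n; apply: lt_le_trans (ue n).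
Unshelve. all: by end_near. Qed.

Lemma open_coinitial_seq (R : realType) (D : set R) (Q : nat -> set R) :
  open D -> D !=set0 ->
  (forall n b, D b -> exists2 z, D z & z <= b /\ Q n z) ->
  exists e : R^nat, [/\ forall m n, (m <= n)%N -> e n <= e m,
    forall n, D (e n), forall n, Q n (e n) & forall z, D z -> exists n, e n < z].
Proof.
move=> oD [p Dp] exQ.
have oD' : open [set z : R | D (- z)].
  by apply: (@open_comp R R (fun z : R => - z) D) => // x _; exact: opp_continuous.
have [|n b Db|e [e1 e2 e3 e4]] := @open_cofinal_seq R [set z | D (- z)] (fun n => [set z | Q n (- z)]) oD'.
- by exists (- p); rewrite /= opprK.
- have [z Dz [zb Qz]] := exQ n (- b) Db.
  by exists (- z); rewrite /= opprK// lerNr.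
- exists (fun n => - e n); split => //.
  + by move=> m n mn; rewrite lerN2 e1.
  + move=> z Dz; have [|n zn] := e4 (- z); first by rewrite /= opprK.
    by exists n; rewrite ltrNl.
Qed.

Section positivity_set.
Context {R : realType} (mu : probability (measurableTypeR R) R) (f : R -> R).
Hypotheses (f_ge0 : forall x, 0 <= f x) (f_cont : continuous f)
  (f_density : has_density mu f).

Let D := [set x | 0 < f x].

Lemma positivity_open : open D.
Proof.
have -> : D = f @^-1` [set y | 0 < y] by [].
by apply: open_comp => //; exact: open_gt.
Qed.

Lemma positivity_measurable : measurable (D : set (measurableTypeR R)).
Proof. exact: open_measurable positivity_open. Qed.

Lemma density_off_positivity : mu (~` D) = 0%E.
Proof.
rewrite f_density; last exact: measurableC positivity_measurable.
by apply: integral0_eq => x /= /negP; rewrite -leNgt => fx; congr EFin; apply/le_anti; rewrite fx f_ge0.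
Qed.

Lemma density_on_positivity : mu D = 1%E.
Proof.
rewrite -[LHS]adde0 -density_off_positivity -measureU//.
- by rewrite setUv; exact: probability_setT.
- exact: positivity_measurable.
- exact: measurableC positivity_measurable.
- by rewrite setICr.
Qed.

Lemma positivity_nonempty : D !=set0.
Proof.
apply/set0P/negP => /eqP D0; have := density_on_positivity.
by rewrite D0 measure0 => /eqP; rewrite eq_sym onee_eq0.
Qed.

Lemma density_lb (c u v : R) : u <= v -> (forall t, u < t <= v -> c <= f t) ->
  c * (v - u) <= fine (mu `]u, v]%classic).
Proof.
move=> uv cf; have [->|uv'] := eqVneq u v.
  by rewrite set_itvoc0 measure0 subrr mulr0.
have luv : u < v by rewrite lt_neqAle uv'.
have muv : measurable (`]u, v]%classic : set (measurableTypeR R)) by [].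
have -> : c * (v - u) = (\int[lebesgue_measure]_(x in `]u, v]) c)%R.
  by rewrite Rintegral_cst//= lebesgue_measure_itv/= lte_fin luv.
rewrite (f_density muv); apply: le_Rintegral => //.
- apply/integrableP; split; first exact/measurable_EFinP/measurable_cst.
  by rewrite /= integral_cst//= lebesgue_measure_itv/= lte_fin luv ltry.
- exact: (density_integrable f_ge0 f_cont f_density).
Qed.

(** Close to [x] the density is at least about f x / 2, so an interval of length d / 2 ending at [x]
    has mass at least (f x / 2) (d / 2). Positive tail masses are what [charged_tail] divides by. *)
Lemma positivity_charged_left x : D x -> 0 < fine (mu `]-oo, x]%classic).
Proof.
move=> Dx; have fx2 : 0 < f x / 2 by rewrite divr_gt0.
have [d d0 Hd] := density_near f_ge0 f_cont f_density x fx2.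
have /(_ _ _ _) := Hd (x - d / 2) x; rewrite ler_norml => h.
have /andP[h1 _] : - (f x / 2 * (x - (x - d / 2))) <= fine (mu `](x - d / 2), x]%classic)
   - f x * (x - (x - d / 2)) <= f x / 2 * (x - (x - d / 2)) by apply: h; lra.
have h2 : fine (mu `](x - d / 2), x]%classic) <= fine (mu `]-oo, x]%classic).
  rewrite fine_le ?fin_num_measure// le_measure ?inE//.
  by apply: subset_itvr; rewrite bnd_simp.
have : 0 < f x / 2 * (d / 2) by rewrite mulr_gt0// divr_gt0.
by lra.
Qed.

Lemma positivity_charged_right x : D x -> 0 < fine (mu `]x, +oo[%classic).
Proof.
move=> Dx; have fx2 : 0 < f x / 2 by rewrite divr_gt0.
have [d d0 Hd] := density_near f_ge0 f_cont f_density x fx2.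
have /(_ _ _ _) := Hd x (x + d / 2); rewrite ler_norml => h.
have /andP[h1 _] : - (f x / 2 * (x + d / 2 - x)) <= fine (mu `]x, (x + d / 2)]%classic)
   - f x * (x + d / 2 - x) <= f x / 2 * (x + d / 2 - x) by apply: h; lra.
have h2 : fine (mu `]x, (x + d / 2)]%classic) <= fine (mu `]x, +oo[%classic).
  rewrite fine_le ?fin_num_measure// le_measure ?inE//.
  by apply: subset_itvl; rewrite bnd_simp.
have : 0 < f x / 2 * (d / 2) by rewrite mulr_gt0// divr_gt0.
by lra.
Qed.

Lemma measure_positivityI (A : set R) : measurable A -> mu (A `&` D) = mu A.
Proof.
move=> mA; have mD := positivity_measurable.
rewrite [RHS](measureDI mu mA mD) [X in (X + _)%E](_ : _ = 0%E) ?add0e//.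
apply/eqP; rewrite eq_le measure_ge0 andbT -density_off_positivity.
by apply: le_measure; rewrite ?inE//; [exact: measurableD|exact: measurableC].
Qed.

(** The sets [A n] need not shrink to the empty set when [D] is bounded; they only leave [D].
    Intersecting with [D], which has full mass, reduces to continuity of [mu] from above at the
    empty set. *)
Lemma tail_cvg (A : nat -> set R) : (forall n, measurable (A n)) ->
  (forall m n, (m <= n)%N -> A n `<=` A m) -> (forall z, D z -> exists n, ~ A n z) ->
  fine (mu (A n)) @[n --> \oo] --> (0 : R).
Proof.
move=> mA niA AD; have mD := positivity_measurable.
have H : mu (A n `&` D) @[n --> \oo] --> mu (\bigcap_n (A n `&` D)).
  apply: nonincreasing_cvg_mu => //.
  - by rewrite -ge0_fin_numE// fin_num_measure//; exact: measurableI (mA _) mD.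
  - by move=> n; exact: measurableI (mA _) mD.
  - by apply: bigcapT_measurable => n; exact: measurableI (mA _) mD.
  - by move=> m n mn; apply/subsetPset; apply: setSI; exact: niA.
apply: (@fine_cvg _ _ _ _ _ (0 : R)).
rewrite (_ : \bigcap_n _ = set0) ?measure0 in H; last first.
  rewrite -subset0 => t tP; have [_ Dt] := tP 0%N I.
  by have [n An] := AD _ Dt; have [] := tP n I.
by under eq_fun do rewrite -measure_positivityI//.
Qed.

End positivity_set.

Lemma le_Rintegral_subset d (T : measurableType d) (R : realType)
    (m : {measure set T -> \bar R}) (A B : set T) (g : T -> R) :
  measurable A -> measurable B -> A `<=` B -> m.-integrable B (EFin \o g) ->
  (\int[m]_(x in A) `|g x| <= \int[m]_(x in B) `|g x|)%R.
Proof.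
move=> mA mB AB ig; have ig' := integrable_norm ig.
have igA := integrableS mB mA AB ig'.
rewrite /Rintegral fine_le ?integrable_fin_num//.
by apply: ge0_subset_integral => //; exact: measurable_int ig'.
Qed.

(** * Behaviour of the density at the ends of D, and the mean of the score *)

Section centered_integral.
Context {R : realType} (mu : probability (measurableTypeR R) R) (f : R -> R).
Hypotheses (f_ge0 : forall x, 0 <= f x) (f_cont : continuous f)
  (f_density : has_density mu f).

Let D := [set x | 0 < f x].

(** Dropping from at least [c] to below [c] would mean dropping to 0, and the intermediate value
    theorem would produce the forbidden value c / 2. *)
Lemma positivity_gap (c u v : R) : 0 < c ->
  (forall t, Num.min u v <= t <= Num.max u v -> 0 < f t -> c <= f t) ->
  c <= f u -> c <= f v.
Proof.
move=> c0 cf cu; rewrite leNgt; apply/negP => vc.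
have fv : f v <= 0.
  rewrite leNgt; apply/negP => fv; have := cf v.
  by rewrite ge_min le_max !lexx !orbT/= => /(_ isT fv); rewrite leNgt vc.
have cw : {within `[Num.min u v, Num.max u v], continuous f} by exact: continuous_subspaceT.
have muv : Num.min u v <= Num.max u v by rewrite ge_min le_max lexx.
have cuv : Num.min (f (Num.min u v)) (f (Num.max u v)) <= c / 2
    <= Num.max (f (Num.min u v)) (f (Num.max u v)).
  rewrite {2}/Num.min {3}/Num.max; case: ltP => uv.
    by rewrite ge_min le_max; apply/andP; split; apply/orP; [right|left]; lra.
  by rewrite ge_min le_max; apply/andP; split; apply/orP; [left|right]; lra.
have [t] := IVT muv cw cuv.
rewrite in_itv/= => tuv ft.
by have := cf t tuv; rewrite ft; lra.
Qed.

(** By [positivity_gap], [f] would stay above [c] on the whole half-line, and an interval of length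
    2 / c would have mass at least 2. *)
Lemma density_vanishes_right (c z : R) : 0 < c ->
  (forall t, z <= t -> 0 < f t -> c <= f t) -> D z -> False.
Proof.
move=> c0 cf Dz.
have cfz t : z <= t -> c <= f t.
  move=> zt; apply: (@positivity_gap _ z) => // [s|]; last exact: cf.
  by rewrite min_l// => /andP[zs _]; exact: cf.
have c2 : 0 < 2 / c by rewrite divr_gt0.
have := @density_lb R mu f f_ge0 f_cont f_density c z (z + 2 / c).
have /[swap]/[apply] : z <= z + 2 / c by lra.
have /[swap]/[apply] : forall t, z < t <= z + 2 / c -> c <= f t.
  by move=> t /andP[/ltW zt _]; exact: cfz.
have -> : c * (z + 2 / c - z) = 2 by field; lra.
have : fine (mu `]z, z + 2 / c]%classic) <= 1.
  by rewrite -[leRHS]/(fine 1%:E) fine_le ?fin_num_measure// probability_le1.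
by lra.
Qed.

Lemma density_vanishes_left (c z : R) : 0 < c ->
  (forall t, t <= z -> 0 < f t -> c <= f t) -> D z -> False.
Proof.
move=> c0 cf Dz.
have cfz t : t <= z -> c <= f t.
  move=> zt; apply: (@positivity_gap _ z) => // [s|]; last exact: cf.
  by rewrite max_l// => /andP[_ zs]; exact: cf.
have c2 : 0 < 2 / c by rewrite divr_gt0.
have := @density_lb R mu f f_ge0 f_cont f_density c (z - 2 / c) z.
have /[swap]/[apply] : z - 2 / c <= z by lra.
have /[swap]/[apply] : forall t, z - 2 / c < t <= z -> c <= f t.
  by move=> t /andP[_ zt]; exact: cfz.
have -> : c * (z - (z - 2 / c)) = 2 by field; lra.
have : fine (mu `]z - 2 / c, z]%classic) <= 1.
  by rewrite -[leRHS]/(fine 1%:E) fine_le ?fin_num_measure// probability_le1.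
by lra.
Qed.

Lemma tail_integral_lt (psi : R -> R) (A : nat -> set R) (e : R) :
  mu.-integrable setT (EFin \o psi) -> (forall n, measurable (A n)) ->
  (forall m n, (m <= n)%N -> A n `<=` A m) -> (forall z, D z -> exists n, ~ A n z) ->
  0 < e -> \forall n \near \oo, (\int[mu]_(x in A n) `|psi x| < e)%R.
Proof.
move=> ipsi mA niA AD e0.
have [d [d0 Hd]] := integral_normr_continuous ipsi e0.
have /cvgrPdist_lt/(_ _ d0)[N _ HN] := tail_cvg f_ge0 f_cont f_density mA niA AD.
exists N => // n /HN /=; rewrite sub0r normrN => An; apply: (Hd _ (mA n)).
have fA : mu (A n) \is a fin_num by apply: fin_num_measure; exact: mA.
rewrite -[X in (X < _)%E]fineK// lte_fin.
by apply: le_lt_trans An; exact: ler_norm.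
Qed.

Lemma null_positivityI_integral (psi : R -> R) (A : set R) :
  measurable A -> mu.-integrable setT (EFin \o psi) -> A `&` D = set0 ->
  (\int[mu]_(x in A) psi x)%R = 0.
Proof.
move=> mA ipsi AD0; rewrite /Rintegral null_set_integral//.
- by apply: measurable_funTS; exact: measurable_int ipsi.
- have := measure_positivityI f_ge0 f_cont f_density mA.
  by rewrite AD0 measure0 => /esym.
Qed.

Variable psi : R -> R.
Hypothesis iD : is_interval D.
Hypothesis ipsi : mu.-integrable setT (EFin \o psi).
Hypothesis df : forall x, D x -> is_lderive f x (- (psi x * f x)).
Hypothesis lcpsi : left_continuous_on D psi.

Let ipsiS (A : set R) : measurable A -> mu.-integrable A (EFin \o psi).
Proof. by move=> mA; exact: integrableS ipsi. Qed.

Let P x := (\int[mu]_(t in `]-oo, x]) psi t)%R.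
Let Q x := (\int[mu]_(t in `]x, +oo[) psi t)%R.

Let integral_tails x : (\int[mu]_t psi t)%R = P x + Q x.
Proof.
rewrite -Rintegral_setU//.
- by rewrite -itv_bndbnd_setU// set_itvNyy.
- by rewrite -itv_bndbnd_setU// set_itvNyy.
- apply/disj_setPLR => t /=; rewrite !in_itv/= andbT => tx.
  by apply/negP; rewrite -leNgt.
Qed.

Let P_sub x y : x <= y -> P y - P x = (\int[mu]_(t in `]x, y]) psi t)%R.
Proof.
move=> xy; have E : `]-oo, y]%classic = `]-oo, x]%classic `|` `]x, y]%classic.
  by rewrite -itv_bndbnd_setU// bnd_simp.
rewrite /P E Rintegral_setU//.
- by ring.
- by rewrite -E; exact: ipsiS.
- apply/disj_setPLR => t /=; rewrite !in_itv/= => tx.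
  by apply/negP; rewrite negb_and -leNgt tx.
Qed.

Let fP_cst x y : D x -> D y -> f x + P x = f y + P y.
Proof.
wlog xy : x y / x <= y => [h Dx Dy|Dx Dy].
  by have [xy|/ltW xy] := leP x y; [exact: h|rewrite (h y x)].
have Dxy t : x < t <= y -> D t.
  by move=> /andP[xt ty]; apply: (iD Dx Dy); rewrite ltW.
have := @left_FTC _ _ _ f_ge0 f_cont f_density _ _ _ xy (fun t h => df (Dxy t h))
  (fun t h => lcpsi (Dxy t h)) (ipsiS _).
rewrite -P_sub//; have mI : measurable (`]x, y]%classic : set (measurableTypeR R)) by [].
by move=> /(_ mI); lra.
Qed.

Let P_small e : 0 < e -> exists2 z, D z & forall t, D t -> t <= z -> `|P t| < e.
Proof.
move=> e0; have [n b Db|a [nia Da _ aD]] :=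
  open_coinitial_seq (Q := fun=> setT) (positivity_open f_cont) (positivity_nonempty f_ge0 f_cont f_density).
  by exists b.
have mA n : measurable (`]-oo, a n]%classic : set (measurableTypeR R)) by [].
have [||N _ HN] := tail_integral_lt ipsi mA _ _ e0.
- move=> m n mn t /=; rewrite !in_itv/= => /le_trans; apply; exact: nia.
- by move=> z /aD[n an]; exists n; rewrite /= in_itv/= leNgt an.
exists (a N) => [|t Dt taN]; first exact: Da.
apply: le_lt_trans (HN N (leqnn N)).
apply: (le_trans (le_normr_Rintegral _ (ipsiS _))) => //.
apply: le_Rintegral_subset => //; last exact: ipsiS.
by apply: subset_itvl; rewrite bnd_simp.
Qed.

Let Q_small e : 0 < e -> exists2 z, D z & forall t, D t -> z <= t -> `|Q t| < e.
Proof.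
move=> e0; have [n b Db|a [nda Da _ aD]] :=
  open_cofinal_seq (Q := fun=> setT) (positivity_open f_cont) (positivity_nonempty f_ge0 f_cont f_density).
  by exists b.
have mA n : measurable (`]a n, +oo[%classic : set (measurableTypeR R)) by [].
have [||N _ HN] := tail_integral_lt ipsi mA _ _ e0.
- by move=> m n mn t /=; rewrite !in_itv/= !andbT; apply: le_lt_trans; exact: nda.
- by move=> z /aD[n an]; exists n; rewrite /= in_itv/= andbT ltNge (ltW an).
exists (a N) => [|t Dt taN]; first exact: Da.
apply: le_lt_trans (HN N (leqnn N)).
apply: (le_trans (le_normr_Rintegral _ (ipsiS _))) => //.
apply: le_Rintegral_subset => //; last exact: ipsiS.
by apply: subset_itvr; rewrite bnd_simp.
Qed.

(** [P] tends to 0 at the left end of [D], so [f] comes close to the constant [C] there. If C > 0,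
    then f >= C / 2 on [D] near that end, which [density_vanishes_left] excludes; C < 0 contradicts
    f >= 0. *)
Let fP0 x : D x -> f x + P x = 0.
Proof.
move=> Dx; set C := f x + P x.
have fC y : D y -> f y + P y = C by move=> Dy; exact: fP_cst.
apply/eqP; rewrite eq_le; apply/andP; split; rewrite leNgt; apply/negP => C0.
- have C2 : 0 < C / 2 by rewrite divr_gt0.
  have [z Dz Pz] := P_small C2.
  apply: (@density_vanishes_left (C / 2) z) => //.
  move=> t tz Dt; have := Pz t Dt tz; have := fC t Dt.
  by rewrite ltr_norml; lra.
- have C2 : 0 < - C by rewrite oppr_gt0.
  have [z Dz Pz] := P_small C2.
  have := Pz z Dz (lexx z); have := fC z Dz; have := f_ge0 z.
  by rewrite ltr_norml; lra.
Qed.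

(** The mirror image of [fP0]: f - Q is constant on [D], and [Q] tends to 0 at the right end. *)
Let integral_psi0 : (\int[mu]_t psi t)%R = 0.
Proof.
have fQ y : D y -> f y - Q y = - (\int[mu]_t psi t)%R.
  by move=> Dy; have := fP0 Dy; rewrite (integral_tails y); lra.
set C := - _ in fQ; suff: C = 0 by rewrite /C; lra.
apply/eqP; rewrite eq_le; apply/andP; split; rewrite leNgt; apply/negP => C0.
- have C2 : 0 < C / 2 by rewrite divr_gt0.
  have [z Dz Qz] := Q_small C2.
  apply: (@density_vanishes_right (C / 2) z) => //.
  move=> t tz Dt; have := Qz t Dt tz; have := fQ t Dt.
  by rewrite ltr_norml; lra.
- have C2 : 0 < - C by rewrite oppr_gt0.
  have [z Dz Qz] := Q_small C2.
  have := Qz z Dz (lexx z); have := fQ z Dz; have := f_ge0 z.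
  by rewrite ltr_norml; lra.
Qed.

(** Outside the interval [D], either nothing of [D] lies to the left of [x] and [P x] is an integral
    over a null set, or nothing lies to the right and [P x] is the full integral, which is 0. *)
Let PE x : P x = - f x.
Proof.
have [Dx|nDx] := pselect (D x); first by have := fP0 Dx; lra.
have fx0 : f x = 0.
  by apply/le_anti; rewrite f_ge0 andbT leNgt; apply/negP.
rewrite fx0 oppr0.
have [[y Dy xy]|nDy] := pselect (exists2 y, D y & x < y).
  apply: null_positivityI_integral => //.
  rewrite -subset0 => t /= []; rewrite in_itv/= => tx Dt.
  by apply: nDx; apply: (iD Dt Dy); rewrite tx ltW.
have := integral_tails x; rewrite integral_psi0 [Q x]null_positivityI_integral//; first lra.
rewrite -subset0 => t /= []; rewrite in_itv/= andbT => xt Dt.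
by apply: nDy; exists t.
Qed.

Lemma centered_integral x :
  (\int[mu]_z (((z <= x)%R%:R - distr_fun mu x) * psi z))%R = - f x.
Proof.
under eq_Rintegral do rewrite mulrBl.
have i1 : mu.-integrable setT (EFin \o (fun z => (z <= x)%R%:R * psi z)).
  rewrite (_ : _ \o _ = (EFin \o psi) \_ `]-oo, x]); last first.
    apply/funext => z /=; rewrite patchE/= mem_setE in_itv/=.
    by case: (z <= x); rewrite ?mul1r ?mul0r.
  by rewrite -integrable_mkcond//; exact: ipsiS.
rewrite RintegralB//; last first.
  exact: (integrableZl _ (distr_fun mu x) ipsi).
rewrite RintegralZl// integral_psi0 mulr0 subr0 -PE /P [RHS]Rintegral_mkcond.
apply: eq_Rintegral => z _; rewrite patchE/= mem_setE in_itv/=.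
by case: (z <= x); rewrite ?mul1r ?mul0r.
Qed.

End centered_integral.

(** * Integrals of the covariance kernel *)

Section covariance.
Context {R : realType} (mu : probability (measurableTypeR R) R).
Local Notation F := (distr_fun mu).

Lemma distr_fun_ge0 x : 0 <= F x.
Proof. by rewrite fine_ge0. Qed.

Lemma distr_fun_le1 x : F x <= 1.
Proof.
by rewrite -[leRHS]/(fine 1%:E) fine_le ?fin_num_measure// probability_le1.
Qed.

Lemma normr_centered_le1 x z : `|(z <= x)%R%:R - F x| <= 1.
Proof.
have := distr_fun_ge0 x; have := distr_fun_le1 x.
by case: (z <= x) => /=; rewrite ler_norml ?mulr1n ?mulr0n; lra.
Qed.

Lemma measurable_le_indic (x : R) :
  measurable_fun setT (fun z : measurableTypeR R => (z <= x)%R%:R : R).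
Proof.
rewrite (_ : (fun _ => _) = \1_`]-oo, x]); first exact: measurable_indic.
by apply/funext => z; rewrite indicE mem_setE in_itv.
Qed.

Lemma measurable_centered x :
  measurable_fun setT (fun z : measurableTypeR R => (z <= x)%R%:R - F x).
Proof. by apply: measurable_funB => //; exact: measurable_le_indic. Qed.

Lemma integrable_centeredM x (k : R -> R) : mu.-integrable setT (EFin \o k) ->
  mu.-integrable setT (EFin \o (fun z => ((z <= x)%R%:R - F x) * k z)).
Proof.
move=> ik; apply: (le_integrable measurableT _ _ ik).
  apply/measurable_EFinP; apply: measurable_funM; first exact: measurable_centered.
  by apply/measurable_EFinP; exact: measurable_int ik.
by move=> z _ /=; rewrite lee_fin normrM ler_piMl// normr_centered_le1.
Qed.

Lemma integrable_le_indic x :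
  mu.-integrable setT (EFin \o (fun z => (z <= x)%R%:R)).
Proof.
apply: measurable_bounded_integrable => //.
- by rewrite (le_lt_trans (probability_le1 mu _)) ?ltry.
- exact: measurable_le_indic.
- exists 1; split => // M M1 z _ /=; rewrite (le_trans _ (ltW M1))//.
  by case: (z <= x); rewrite ?normr1 ?normr0.
Qed.

Lemma Rintegral_le_indic x : (\int[mu]_z (z <= x)%R%:R)%R = F x.
Proof.
rewrite /Rintegral (_ : (fun _ => _) = EFin \o \1_`]-oo, x]).
  by rewrite integral_indic// setIT.
by apply/funext => z /=; rewrite indicE mem_setE in_itv.
Qed.

Lemma Kmu_centered x y :
  (\int[mu]_z (((z <= x)%R%:R - F x) * (z <= y)%R%:R))%R = Kmu mu x y.
Proof.
under eq_Rintegral => z _.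
  rewrite mulrBl -natrM mulnb -le_min.
  over.
rewrite RintegralB//; last 2 first.
- exact: integrable_le_indic.
- exact: (integrableZl _ (F x) (integrable_le_indic y)).
by rewrite RintegralZl ?Rintegral_le_indic//; exact: integrable_le_indic.
Qed.

(** Fubini's theorem for [u]. Since the centered indicator has modulus at most 1 and [mu] has mass
    1, the integral of |u| over the first variable is at most |h y|, so integrability of [h]
    suffices. *)
Lemma covariance_swap (m : {sigma_finite_measure set (measurableTypeR R) -> \bar R})
    (h : R -> R) x : m.-integrable setT (EFin \o h) ->
  (\int[m]_y (Kmu mu x y * h y)%:E =
   \int[mu]_z (((z <= x)%R%:R - F x) * \int[m]_(y in `[z, +oo[) h y)%:E)%E.
Proof.
move=> ih.
have mh : measurable_fun setT h by apply/measurable_EFinP; exact: measurable_int ih.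
pose u (p : measurableTypeR R * measurableTypeR R) : \bar R :=
  (((p.1 <= x)%R%:R - F x) * (p.1 <= p.2)%R%:R * h p.2)%:E.
have mu_ : measurable_fun setT u.
  apply/measurable_EFinP; apply: measurable_funM; last exact: measurableT_comp.
  apply: measurable_funM; first exact: (measurableT_comp (measurable_centered x)).
  rewrite (_ : (fun _ => _) = \1_[set p : measurableTypeR R * measurableTypeR R | p.1 <= p.2]).
    apply: measurable_indic; rewrite -[X in measurable X]setTI.
    by apply: measurable_fun_ler.
  by apply/funext => p; rewrite indicE mem_setE.
have iu : (mu \x m)%E.-integrable setT u.
  apply/(integrable21ltyP _ _ mu_); case/integrableP: ih => _.
  apply: le_lt_trans.
  have mua : measurable_fun setT (abse \o u) by exact: measurableT_comp.
  apply: ge0_le_integral => //.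
  - by move=> y _; apply: integral_ge0 => z _; exact: abse_ge0.
  - apply: (measurable_fun_fubini_tonelli_G  (abse \o u)); [exact: mua|by move=> p; exact: abse_ge0].
  - by apply: measurableT_comp => //; exact/measurable_EFinP.
  - move=> y _.
    have -> : `|(EFin \o h) y|%E = (\int[mu]_z cst `|h y|%:E z)%E.
      rewrite integral_cst// [X in (_ * X)%E](_ : _ = 1%E) ?mule1//.
      exact: probability_setT.
    apply: ge0_le_integral => //.
    + exact: (measurableT_comp mua (measurable_pair2 y)).
    + move=> z _ /=; rewrite lee_fin normrM ler_piMl// normrM mulr_ile1//.
        exact: normr_centered_le1.
      by case: (z <= y); rewrite ?normr1 ?normr0.
have := Fubini iu => /esym.
have ic y : mu.-integrable setT (EFin \o (fun z => ((z <= x)%R%:R - F x) * (z <= y)%R%:R)).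
  apply: measurable_bounded_integrable => //.
  - by rewrite (le_lt_trans (probability_le1 mu _)) ?ltry.
  - by apply: measurable_funM; [exact: measurable_centered|exact: measurable_le_indic].
  - exists 1; split => // M M1 z _ /=; rewrite (le_trans _ (ltW M1))//.
    rewrite normrM mulr_ile1//; first exact: normr_centered_le1.
    by case: (z <= y); rewrite ?normr1 ?normr0.
rewrite (@eq_integral _ _ _ m _ (fun y => (Kmu mu x y * h y)%:E)); last first.
  move=> y _; rewrite -Kmu_centered EFinM.
  under [LHS]eq_integral do rewrite /u/= EFinM.
  rewrite integralZr//; last exact: ic.
  by rewrite /Rintegral fineK//; apply: integrable_fin_num => //; exact: ic.
move=> ->; apply: eq_integral => z _; rewrite /u/=.
have ihz : m.-integrable `[z, +oo[ (EFin \o h) by exact: integrableS ih.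
rewrite EFinM /Rintegral fineK; last exact: integrable_fin_num.
rewrite -integralZl//= [RHS]integral_mkcond; apply: eq_integral => y _.
rewrite patchE mem_setE/= in_itv/= andbT.
by case: (z <= y); rewrite ?mulr1 ?mulr0 ?mul0r.
Qed.

End covariance.

(** * The Stieltjes form of the identity *)

Section stieltjes_covariance.
Context {R : realType} (mu : probability (measurableTypeR R) R).
Local Notation F := (distr_fun mu).

(** A Stieltjes measure comes as a bare measure whose sigma-finiteness is proved afterwards; the
    proof packs it into the structure that Fubini's theorem asks for. *)
Lemma covariance_swap_sigma_finite (nu : {measure set (measurableTypeR R) -> \bar R})
    (h : R -> R) x : sigma_finite setT nu -> nu.-integrable setT (EFin \o h) ->
  (\int[nu]_y (Kmu mu x y * h y)%:E =
   \int[mu]_z (((z <= x)%R%:R - F x) * \int[nu]_(y in `[z, +oo[) h y)%:E)%E.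
Proof.
move=> sf.
pose H1 := isSFinite.Build _ _ _ (Measure.sort nu) (sfinite_measure_sigma_finite sf).
pose H2 := isSigmaFinite.Build _ _ _ (Measure.sort nu) sf.
pose nu' : {sigma_finite_measure set (measurableTypeR R) -> \bar R} :=
  HB.pack (Measure.sort nu) H1 H2.
exact: (@covariance_swap R mu nu' h x).
Qed.

Definition clamp (a b z : R) : R := Num.max a (Num.min z b).

Lemma clamp_ge a b z : a <= clamp a b z.
Proof. by rewrite /clamp le_max lexx. Qed.

Lemma clamp_le a b z : a <= b -> clamp a b z <= b.
Proof. by move=> ab; rewrite /clamp ge_max ab ge_min lexx orbT. Qed.

Lemma clamp_id a b z : a <= z <= b -> clamp a b z = z.
Proof. by move=> /andP[az zb]; rewrite /clamp min_l// max_r. Qed.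

Lemma clamp_itvco a b z : a <= b ->
  `[z, +oo[%classic `&` `[a, b[%classic = `[clamp a b z, b[%classic :> set R.
Proof.
move=> ab; apply/seteqP; split => t /=; rewrite !in_itv/= andbT.
  by move=> [zt /andP[at_ tb]]; rewrite tb andbT ge_max at_ ge_min zt.
rewrite /clamp ge_max ge_min => /andP[/andP[-> /orP[->|bt]] tb]; rewrite ?tb//.
by move: bt; rewrite leNgt tb.
Qed.

(* The constant g b drops out as the centered indicator has mean 0. *)
Lemma covariance_clamp (nu : {measure set (measurableTypeR R) -> \bar R})
    (h g : R -> R) a b x : sigma_finite setT nu -> nu.-integrable setT (EFin \o h) ->
  (forall z, (\int[nu]_(y in `[z, +oo[) h y)%R = g b - g (clamp a b z)) ->
  mu.-integrable setT (EFin \o (g \o clamp a b)) ->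
  (\int[nu]_y (Kmu mu x y * h y)%:E =
   (- \int[mu]_z (((z <= x)%R%:R - F x) * g (clamp a b z)))%R%:E)%E.
Proof.
move=> sf ih hg ig; rewrite (covariance_swap_sigma_finite _ sf ih).
under eq_integral do rewrite hg.
have icst : mu.-integrable setT (EFin \o cst (g b)).
  exact: finite_measure_integrable_cst.
have i1 := integrable_centeredM x icst; have i2 := integrable_centeredM x ig.
rewrite -[LHS]fineK; last first.
  apply: integrable_fin_num => //.
  apply: (@integrable_centeredM _ _ x (fun z => g b - g (clamp a b z))).
  exact: (integrableB measurableT icst ig).
congr EFin.
rewrite [LHS](_ : _ = (\int[mu]_z (((z <= x)%R%:R - F x) * cst (g b) z
    - ((z <= x)%R%:R - F x) * g (clamp a b z)))%R); last first.
  by apply: eq_Rintegral => z _; rewrite mulrBr.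
rewrite RintegralB// RintegralZr//; last first.
  exact: (integrableB measurableT (integrable_le_indic mu x)
    (finite_measure_integrable_cst mu (F x) measurableT)).
rewrite RintegralB//; last 2 first.
- exact: integrable_le_indic.
- exact: finite_measure_integrable_cst.
rewrite Rintegral_le_indic Rintegral_cst//.
rewrite [X in fine X](_ : _ = 1%E); last exact: probability_setT.
by rewrite mulr1 subrr mul0r sub0r.
Qed.

Lemma distr_fun_le x y : x <= y -> F x <= F y.
Proof.
move=> xy; rewrite fine_le ?fin_num_measure// le_measure ?inE//.
by apply: subset_itvl; rewrite bnd_simp.
Qed.

Lemma measurable_distr_fun (A : set (measurableTypeR R)) :
  measurable A -> measurable_fun A F.
Proof. by move=> mA; apply: nondecreasing_measurable => // x y; exact: distr_fun_le. Qed.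

(** For x <= y the kernel is F(x) (1 - F(y)). *)
Lemma Kmu_ge0 x y : 0 <= Kmu mu x y.
Proof.
have Fx := distr_fun_ge0 mu x; have Fx1 := distr_fun_le1 mu x.
have Fy := distr_fun_ge0 mu y; have Fy1 := distr_fun_le1 mu y.
by rewrite /Kmu; case: (leP x y) => xy; nra.
Qed.

Lemma measurable_Kmu x : measurable_fun setT (Kmu mu x : measurableTypeR R -> R).
Proof.
apply: measurable_funB; last exact: measurable_funM (measurable_distr_fun measurableT).
apply: nondecreasing_measurable => // s t st; apply: distr_fun_le.
by rewrite le_min !ge_min lexx st !orbT.
Qed.

(** On the left the limit is monotone convergence, as the kernel is nonnegative and [nu] does not
    charge the complement of [D]. On the right it is dominated convergence, and monotonicity of [g]
    supplies the dominating function |g| + |g (a 0)|. *)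
Lemma stieltjes_covariance (D : set R) (g : R -> R)
    (nu : {measure set (measurableTypeR R) -> \bar R}) x :
  open D -> is_interval D -> D !=set0 -> mu (~` D) = 0%E ->
  nondecreasing_on D g -> is_stieltjes D g nu ->
  mu.-integrable D (EFin \o g) ->
  (\int[nu]_y (Kmu mu x y)%:E =
   (- \int[mu]_z (((z <= x)%R%:R - F x) * (g \_ D) z))%R%:E)%E.
Proof.
move=> oD iD D0 muD ndg [nuD nuI] ig.
have mD : measurable (D : set (measurableTypeR R)) by exact: open_measurable.
have [n b Db|a [nia Da _ aD]] := open_coinitial_seq (Q := fun=> setT) oD D0.
  by exists b.
(* Forcing every [b n] beyond [a 0] keeps [a 0] in all the intervals; it is the anchor of the
   dominating function [G]. *)
have [n c Dc|b [ndb Db ab bD]] := open_cofinal_seq (Q := fun=> [set z | a 0%N < z]) oD D0.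
  have [n' b' Db'|e [_ De _ eD]] := open_cofinal_seq (Q := fun=> setT) oD D0.
    by exists b'.
  have [m am] := eD _ (Da 0%N); exists (Num.max c (e m)).
    by rewrite /Num.max; case: ifP.
  by rewrite /= le_max lexx lt_max am orbT.
have a0n n : a n <= a 0%N by exact: nia.
have lab n : a n <= b n by rewrite ltW// (le_lt_trans (a0n n))// ab.
pose E n := `[a n, b n[%classic : set (measurableTypeR R).
have mE n : measurable (E n) by exact: measurable_itv.
have ED : \bigcup_n E n = D.
  apply/seteqP; split => [t [n _] /=|t Dt].
    by rewrite /E/= in_itv/= => /andP[at_ /ltW tb]; apply: (iD _ _ (Da n) (Db n)); rewrite at_.
  have [m am] := aD _ Dt; have [n bn] := bD _ Dt; exists (maxn m n) => //=.
  rewrite /E/= in_itv/= (le_trans (nia _ _ (leq_maxl m n)) (ltW am))/=.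
  by rewrite (lt_le_trans bn)// ndb// leq_maxr.
have nuE n : nu (E n) = (g (b n) - g (a n))%:E by exact: nuI.
have sf : sigma_finite setT nu.
  exists (fun n => if n is k.+1 then E k else ~` D).
    apply/esym; rewrite -subTset => t _; have [Dt|nDt] := pselect (D t); last by exists 0%N.
    by move: Dt; rewrite -ED => -[n _ Ent]; exists n.+1.
  case=> [|n]; first by rewrite nuD ltry; split => //; exact: measurableC.
  by rewrite nuE ltry; split => //; exact: measurable_itv.
have mK : measurable_fun setT (EFin \o (Kmu mu x : measurableTypeR R -> R)).
  by apply/measurable_EFinP; exact: measurable_Kmu.
have K0 y : (0 <= (Kmu mu x y)%:E)%E by rewrite lee_fin Kmu_ge0.
have cvgL : (\int[nu]_(y in E n) (Kmu mu x y)%:E)%E @[n --> \oo] --> (\int[nu]_y (Kmu mu x y)%:E)%E.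
  rewrite (@ge0_negligible_integral _ _ _ nu setT (~` D))//; last exact: measurableC.
  rewrite setTD setCK -ED; apply: ge0_nondecreasing_set_cvg_integral => //.
  - move=> m n mn; apply/subsetPset => t; rewrite /E/= !in_itv/= => /andP[at_ tb].
    by rewrite (le_trans (nia _ _ mn) at_)/= (lt_le_trans tb)// ndb.
  - by move=> n; exact: measurable_funTS.
have ndgc n : {homo (g \o clamp (a n) (b n)) : s t / s <= t}.
  move=> s t st /=; apply: ndg.
  - by apply: (iD _ _ (Da n) (Db n)); rewrite clamp_ge clamp_le.
  - by apply: (iD _ _ (Da n) (Db n)); rewrite clamp_ge clamp_le.
  - by rewrite /clamp ge_max !le_max lexx/= le_min !ge_min st lexx !orbT.
have mgc n : measurable_fun setT (g \o clamp (a n) (b n) : measurableTypeR R -> R).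
  by apply: nondecreasing_measurable => // s t; exact: ndgc.
have igc n : mu.-integrable setT (EFin \o (g \o clamp (a n) (b n))).
  apply: measurable_bounded_integrable => //.
    by rewrite (le_lt_trans (probability_le1 mu _)) ?ltry.
  exists (`|g (a n)| + `|g (b n)|); split => // M M1 z _ /=; rewrite (le_trans _ (ltW M1))//.
  have gab c : D c -> a n <= c -> c <= b n -> `|g c| <= `|g (a n)| + `|g (b n)|.
    move=> Dc ac cb; rewrite ler_norml; have := ndg _ _ (Da n) Dc ac; have := ndg _ _ Dc (Db n) cb.
    have := ler_norm (g (b n)); have := ler_norm (- g (a n)); rewrite normrN.
    have := normr_ge0 (g (a n)); have := normr_ge0 (g (b n)); lra.
  apply: gab; rewrite ?clamp_ge ?clamp_le//.
  by apply: (iD _ _ (Da n) (Db n)); rewrite clamp_ge clamp_le.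
have KE n : (\int[nu]_(y in E n) (Kmu mu x y)%:E =
    (- \int[mu]_z (((z <= x)%R%:R - F x) * g (clamp (a n) (b n) z)))%R%:E)%E.
  rewrite -(@covariance_clamp nu (\1_(E n)) g)//.
  - rewrite integral_mkcond; apply: eq_integral => y _.
    by rewrite patchE indicE; case: ifP; rewrite ?mulr1 ?mulr0.
  - apply/integrableP; split.
      by apply/measurable_EFinP; apply: measurable_indic; exact: measurable_itv.
    rewrite (@eq_integral _ _ _ nu _ (EFin \o \1_(E n))).
      by rewrite integral_indic ?setIT ?nuE ?ltry//; exact: measurable_itv.
    by move=> y _ /=; rewrite ger0_norm.
  - move=> z; rewrite /Rintegral integral_indic// setIC clamp_itvco// nuI ?clamp_le//.
    by apply: (iD _ _ (Da n) (Db n)); rewrite clamp_ge clamp_le.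
have igD : mu.-integrable setT (EFin \o (g \_ D)).
  by rewrite -restrict_EFin -integrable_mkcond.
have mgD : measurable_fun setT (g \_ D : measurableTypeR R -> R).
  by apply/measurable_EFinP; exact: measurable_int igD.
have mc : measurable_fun setT (fun z : measurableTypeR R => (z <= x)%R%:R - F x).
  exact: measurable_centered.
pose G (z : measurableTypeR R) : \bar R := (`|(g \_ D) z| + `|g (a 0%N)|)%:E.
have iG : mu.-integrable setT G.
  exact: (integrableD measurableT (integrable_norm igD)
    (finite_measure_integrable_cst mu `|g (a 0%N)| measurableT)).
have aeD : {ae mu, forall z, D z}.
  by exists (~` D); split => //; exact: measurableC.
pose f_ (n : nat) (z : measurableTypeR R) : \bar R := (((z <= x)%R%:R - F x) * g (clamp (a n) (b n) z))%:E.
pose f (z : measurableTypeR R) : \bar R := (((z <= x)%R%:R - F x) * (g \_ D) z)%:E.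
have mf_ n : measurable_fun setT (f_ n).
  by apply/measurable_EFinP; exact: (measurable_funM mc (mgc n)).
have mf : measurable_fun setT f.
  by apply/measurable_EFinP; exact: (measurable_funM mc mgD).
have f_f : {ae mu, forall z : measurableTypeR R, setT z -> f_ ^~ z @ \oo --> f z}.
  apply: (@filterS _ _ (ae_filter_ringOfSetsType mu) _ _ _ aeD) => z Dz _; apply: cvg_near_cst.
  have : (\bigcup_n E n) z by rewrite ED.
  move=> [N _]; rewrite /E/= in_itv/= => /andP[az zb].
  exists N => // n /= Nn; rewrite /f /f_ patchE mem_set// clamp_id//.
  by rewrite (le_trans (nia _ _ Nn) az)/= (le_trans (ltW zb))// ndb.
have f_G : {ae mu, forall (z : measurableTypeR R) n, setT z -> `|f_ n z| <= G z}%E.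
  apply: (@filterS _ _ (ae_filter_ringOfSetsType mu) _ _ _ aeD) => z Dz n _.
  rewrite /G lee_fin patchE mem_set// normrM.
  apply: (@le_trans _ _ `|g (clamp (a n) (b n) z)|).
    by rewrite ler_piMl// normr_centered_le1.
  have Dcz : D (clamp (a n) (b n) z).
    by apply: (iD _ _ (Da n) (Db n)); rewrite clamp_ge clamp_le.
  (* The clamped point is [z] itself or lies between [z] and [a 0], so the value of [g] there lies
     between [g z] and [g (a 0)]. *)
  have [zc|zc] : z <= clamp (a n) (b n) z <= a 0%N \/ (a 0%N <= clamp (a n) (b n) z <= z)
      \/ clamp (a n) (b n) z = z.
    have [zan|anz] := ltP z (a n).
      left; rewrite /clamp min_l ?max_l ?(ltW zan)//; last exact: (le_trans (ltW zan)).
      by rewrite a0n.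
    have [bnz|zbn] := leP (b n) z; last by right; right; rewrite clamp_id// anz ltW.
    by right; left; rewrite /clamp min_r// max_r// bnz (ltW (ab n)).
  - case/andP: zc => zc ca; have := ndg _ _ Dz Dcz zc; have := ndg _ _ Dcz (Da 0%N) ca.
    set w := g (clamp _ _ _) => h1 h2.
    have := ler_norm (g (a 0%N)); have := ler_norm (- g z); rewrite normrN.
    have := normr_ge0 (g (a 0%N)); have := normr_ge0 (g z).
    by rewrite ler_norml; lra.
  - case: zc => [/andP[ac cz]|->]; last by rewrite lerDl.
    have := ndg _ _ Dcz Dz cz; have := ndg _ _ (Da 0%N) Dcz ac.
    set w := g (clamp _ _ _) => h1 h2.
    have := ler_norm (- g (a 0%N)); have := ler_norm (g z); rewrite normrN.
    have := normr_ge0 (g (a 0%N)); have := normr_ge0 (g z).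
    by rewrite ler_norml; lra.
have [icg _ cvgR] := dominated_convergence measurableT mf_ mf f_f iG f_G.
have cvgR' : (- \int[mu]_z (((z <= x)%R%:R - F x) * g (clamp (a n) (b n) z)))%R%:E @[n --> \oo]
  --> (- \int[mu]_z (((z <= x)%R%:R - F x) * (g \_ D) z))%R%:E.
  have if_ n : (\int[mu]_z f_ n z)%E \is a fin_num.
    by apply: integrable_fin_num => //; exact: integrable_centeredM (igc n).
  have -> : (- \int[mu]_z (((z <= x)%R%:R - F x) * (g \_ D) z))%R%:E = (- \int[mu]_z f z)%E.
    by rewrite EFinN /Rintegral fineK// integrable_fin_num.
  rewrite (_ : (fun _ => _) = (fun n => - \int[mu]_z f_ n z)%E); first exact: cvgeN.
  by apply/funext => n; rewrite EFinN /Rintegral; congr (- _)%E; apply: fineK; exact: if_.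
have cvgL' : (- \int[mu]_z (((z <= x)%R%:R - F x) * g (clamp (a n) (b n) z)))%R%:E @[n --> \oo]
    --> (\int[nu]_y (Kmu mu x y)%:E)%E.
  by apply: cvg_trans cvgL; apply: near_eq_cvg; apply: nearW => n; rewrite KE.
exact: (cvg_unique (@ereal_hausdorff R) cvgL' cvgR').
Qed.

End stieltjes_covariance.

(** * Absolutely continuous functions *)

Section absolute_continuity.
Context {R : realType}.
Implicit Types (a b e : R) (g h : R -> R).

(** Arbitrary finite index types are allowed because the subintervals of several partitions are
    naturally indexed by dependent pairs. *)
Lemma abs_cont_fin a b g : abs_cont a b g -> forall e, 0 < e -> exists2 d, 0 < d &
  forall (I : finType) (u v : I -> R),
    (forall i, a <= u i /\ u i <= v i /\ v i <= b) ->
    trivIset setT (fun i => `]u i, v i[%classic) ->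
    \sum_(i : I) (v i - u i) < d -> \sum_(i : I) `|g (v i) - g (u i)| < e.
Proof.
move=> acg e e0; have [d d0 Hd] := acg e e0; exists d => // I u v uv tuv.
have sumE (F : I -> R) : \sum_(i : I) F i = \sum_(i < #|I|) F (enum_val i).
  by rewrite -big_enum_val; apply: eq_bigl.
rewrite !sumE => suv.
apply: (Hd #|I| (u \o enum_val) (v \o enum_val)) => //=.
by move=> i j _ _ ij; apply: enum_val_inj; exact: tuv.
Qed.

Lemma abs_contB a b g h : abs_cont a b g -> abs_cont a b h ->
  abs_cont a b (fun x => g x - h x).
Proof.
move=> acg ach e e0; have e2 : 0 < e / 2 by rewrite divr_gt0.
have [d d0 Hd] := acg _ e2; have [d' d'0 Hd'] := ach _ e2.
exists (Num.min d d'); first by rewrite lt_min d0.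
move=> n u v uv tuv; rewrite lt_min => /andP[/(Hd _ _ _ uv tuv) h1 /(Hd' _ _ _ uv tuv) h2].
apply: (@le_lt_trans _ _ (\sum_(i < n) (`|g (v i) - g (u i)| + `|h (v i) - h (u i)|))); last first.
  by rewrite big_split /=; lra.
apply: ler_sum => i _.
rewrite (_ : g (v i) - h (v i) - _ = (g (v i) - g (u i)) - (h (v i) - h (u i))); last by ring.
exact: ler_normB.
Qed.

Lemma abs_cont_modulus a b g : abs_cont a b g -> forall e, 0 < e -> exists2 d, 0 < d &
  forall x y, a <= x -> x <= y -> y <= b -> y - x < d -> `|g y - g x| < e.
Proof.
move=> acg e e0; have [d d0 Hd] := acg e e0; exists d => // x y ax xy yb xyd.
have := Hd 1%N (fun=> x) (fun=> y); rewrite !big_ord1; apply => //.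
by move=> i j _ _ _; rewrite !ord1.
Qed.

(** Cutting each interval along a partition keeps the total length and the disjointness, so the
    pieces of all the partitions together form one admissible family. *)
Lemma abs_cont_variation a b g : abs_cont a b g -> forall e, 0 < e -> exists2 d, 0 < d &
  forall n (u v : 'I_n -> R) (s : 'I_n -> seq R),
    (forall i, a <= u i /\ v i <= b) ->
    (forall i, itv_partition (u i) (v i) (s i)) ->
    trivIset setT (fun i => `]u i, v i[%classic) ->
    \sum_(i < n) (v i - u i) < d ->
    \sum_(i < n) variation (u i) (v i) g (s i) < e.
Proof.
move=> acg e e0; have [d d0 Hd] := abs_cont_fin acg e0; exists d => // n u v s uv ps tuv suv.
pose I := {i : 'I_n & 'I_(size (s i))}.
pose x (i : 'I_n) := nth (v i) (u i :: s i).
have x_ge i k : (k < (size (s i)).+1)%N -> u i <= x i k.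
  by move=> ks; exact: itv_partition_nth_ge (ps i).
have x_le i k : (k < (size (s i)).+1)%N -> x i k <= v i.
  by move=> ks; exact: itv_partition_nth_le (ps i).
have x_lt i (k : nat) : (k < size (s i))%N -> x i k < x i k.+1.
  by case: (ps i) => /(pathP (v i)) h _; exact: h.
have x_mono i (j k : nat) : (j <= k)%N -> (k < (size (s i)).+1)%N -> x i j <= x i k.
  elim: k => [|k IH]; first by rewrite leqn0 => /eqP ->.
  rewrite leq_eqVlt => /predU1P[->//|jk] ks.
  by rewrite (le_trans (IH jk (ltnW ks)))// ltW// x_lt.
have varE (h : R -> R) : \sum_(i < n) variation (u i) (v i) h (s i) =
    \sum_(p : I) `|h (x (tag p) (tagged p).+1) - h (x (tag p) (tagged p))|.
  rewrite (_ : \sum_(p : I) _ = \sum_(i < n) \sum_(j < size (s i)) `|h (x i j.+1) - h (x i j)|).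
    by apply: eq_bigr => i _; rewrite /variation big_mkord.
  by rewrite sig_big_dep.
(* The lengths telescope: on each interval they add up to the variation of the identity. *)
have lenE : \sum_(p : I) (x (tag p) (tagged p).+1 - x (tag p) (tagged p)) = \sum_(i < n) (v i - u i).
  rewrite (_ : \sum_(i < n) _ = \sum_(i < n) variation (u i) (v i) id (s i)); last first.
    apply: eq_bigr => i _; have nid : {in `[u i, v i] &, nondecreasing_fun (@id R)} by move=> ? ? _ _.
    by rewrite (nondecreasing_variation nid (ps i)).
  rewrite varE; apply: eq_bigr => -[i j] _ /=.
  by rewrite ger0_norm// subr_ge0 ltW// x_lt.
rewrite varE; apply: (Hd I (fun p => x (tag p) (tagged p)) (fun p => x (tag p) (tagged p).+1)).
- move=> [i j] /=; case: (uv i) => au vb; split; last split.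
  + by rewrite (le_trans au)// x_ge// ltnS ltnW.
  + by rewrite ltW// x_lt.
  + by rewrite (le_trans _ vb)// x_le// ltnS.
(* Pieces that meet come from the same partition, because the intervals []u i, v i[] are disjoint;
   within one partition the points increase. *)
- move=> [i j] [k l] _ _ /= [t [/=]]; rewrite !in_itv/= => /andP[t1 t2] /andP[t3 t4].
  have ik : i = k.
    apply: tuv => //; exists t; split; rewrite /= in_itv/=.
      by rewrite (le_lt_trans _ t1) ?(lt_le_trans t2)// ?x_le ?x_ge// ltnS// ltnW.
    by rewrite (le_lt_trans _ t3) ?(lt_le_trans t4)// ?x_le ?x_ge// ltnS// ltnW.
  subst k; congr existT; apply: val_inj => /=.
  have [jl|jl|//] := ltngtP j l.
    have := x_mono i _ _ jl (ltnW (ltn_ord l)).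
    by rewrite leNgt (lt_trans t3 t2).
  have := x_mono i _ _ jl (ltnW (ltn_ord j)).
  by rewrite leNgt (lt_trans t1 t4).
- by rewrite lenE.
Qed.

Local Notation TV := (@total_variation R).

(** On a piece shorter than [d] every partition has variation below 1. Steps of length d / 2 and
    additivity of the total variation then reach any point of [a, b]. *)
Lemma abs_cont_total_variation_fin a b g : abs_cont a b g ->
  forall x, a <= x <= b -> TV a x g \is a fin_num.
Proof.
move=> acg; have [d d0 Hd] := abs_cont_variation acg ltr01.
have TV1 x y : a <= x -> x <= y -> y <= b -> y - x < d -> TV x y g \is a fin_num.
  move=> ax xy yb xyd; apply/(bounded_variationP _ xy); exists 1 => _ [s ps <-].
  have := Hd 1%N (fun=> x) (fun=> y) (fun=> s); rewrite !big_ord1 => h.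
  by apply/ltW/h => // i j _ _ _; rewrite !ord1.
suff H (k : nat) x : a <= x <= b -> x - a < k%:R * (d / 2) -> TV a x g \is a fin_num.
  move=> x axb; have d2 : 0 < d / 2 by rewrite divr_gt0.
  apply: (H (Num.truncn ((x - a) / (d / 2))).+1) => //.
  by rewrite -ltr_pdivrMr// truncnS_gt.
elim: k x => [|k IH] x /andP[ax xb].
  by rewrite mul0r subr_lt0 ltNge ax.
have [xd _|dx] := ltP (x - a) d; first exact: TV1.
rewrite -natr1 mulrDl mul1r => xk.
have axd : a <= x - d / 2 by lra.
rewrite (total_variationD _ axd); last by lra.
rewrite fin_numD IH//=; last 2 first.
- by rewrite axd/=; lra.
- by lra.
by apply: TV1 => //; lra.
Qed.

Lemma total_variation_sub a b g x y : abs_cont a b g ->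
  a <= x -> x <= y -> y <= b ->
  (fine (TV a y g) - fine (TV a x g))%:E = TV x y g.
Proof.
move=> acg ax xy yb; have TVx := abs_cont_total_variation_fin acg.
have fx : TV a x g \is a fin_num by apply: TVx; rewrite ax (le_trans xy).
have fy : TV a y g \is a fin_num by apply: TVx; rewrite (le_trans ax).
have fxy : TV x y g \is a fin_num.
  by move: fy; rewrite (total_variationD _ ax xy) fin_numD => /andP[].
by rewrite (total_variationD _ ax xy) fineD// addrAC subrr add0r fineK.
Qed.

Lemma abs_cont_total_variation a b g : abs_cont a b g ->
  abs_cont a b (fun x => fine (TV a x g)).
Proof.
move=> acg e e0; have e2 : 0 < e / 2 by rewrite divr_gt0.
have [d d0 Hd] := abs_cont_variation acg e2; exists d => // n u v uv tuv suv.
(* Each total variation is replaced by the variation along a partition at cost [eta]; the n costs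
   add up to less than e / 2. *)
pose eta := e / 2 / n.+1%:R; have eta0 : 0 < eta by rewrite divr_gt0.
have exs i : exists s, itv_partition (u i) (v i) s /\
    fine (TV a (v i) g) - fine (TV a (u i) g) < variation (u i) (v i) g s + eta.
  have [au [ui vb]] := uv i.
  have TVE := total_variation_sub acg au ui vb.
  have fT : TV (u i) (v i) g \is a fin_num by rewrite -TVE.
  have [_ [_ [s ps <-] <-]] := ub_ereal_sup_adherent eta0 fT.
  rewrite -/(TV (u i) (v i) g) -TVE -EFinB lte_fin => h; exists s; split => //.
  by lra.
have [s Hs] := choice exs.
have := Hd n u v s (fun i => conj (uv i).1 (uv i).2.2) (fun i => (Hs i).1) tuv suv.
have ne : n%:R * eta < e / 2.
  by rewrite /eta mulrCA gtr_pMr// ltr_pdivrMr// mul1r ltr_nat.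
suff : \sum_(i < n) `|fine (TV a (v i) g) - fine (TV a (u i) g)|
    <= \sum_(i < n) variation (u i) (v i) g (s i) + n%:R * eta by lra.
have -> : n%:R * eta = \sum_(i < n) eta by rewrite sumr_const card_ord mulr_natl.
rewrite -big_split/=; apply: ler_sum => i _.
have [au [ui vb]] := uv i.
rewrite ger0_norm; first by case: (Hs i) => _ /ltW.
by rewrite -lee_fin (total_variation_sub acg)// total_variation_ge0.
Qed.

End absolute_continuity.

(** * Absolutely continuous functions as integrals *)

Section absolutely_continuous_density.
Context {R : realType}.
Implicit Types (a b : R) (V g : R -> R).
Local Notation lambda := (@lebesgue_measure R).

Lemma clamp_mono a b s t : s <= t -> clamp a b s <= clamp a b t.
Proof. by move=> st; rewrite /clamp ge_max !le_max lexx/= le_min !ge_min st lexx !orbT. Qed.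

Lemma clamp_lip a b s t : s <= t -> clamp a b t - clamp a b s <= t - s.
Proof.
rewrite /clamp /Num.max /Num.min => st.
by case: (ltP t b) => ?; case: (ltP s b) => ?; do 2 case: ltP => ?; lra.
Qed.

Section monotone.
Variables (a b : R) (V : R -> R).
Hypotheses (ab : a <= b) (acV : abs_cont a b V)
  (ndV : {in `[a, b] &, {homo V : x y / x <= y}}).

(** Extending [V] by constants gives a nondecreasing left-continuous function on the open set
    [setT], to which [stieltjesP] applies. *)
Let W := V \o clamp a b.

Let clampP x : clamp a b x \in `[a, b].
Proof. by rewrite in_itv/= clamp_ge clamp_le. Qed.

Let W_nd : nondecreasing_on setT W.
Proof. by move=> x y _ _ xy; apply: ndV; rewrite ?clampP// clamp_mono. Qed.

Let W_lc : left_continuous_on setT W.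
Proof.
move=> x _; apply/cvgrPdist_lt => e e0; have [d d0 Hd] := abs_cont_modulus acV e0.
near=> y; apply: Hd; rewrite ?clamp_ge ?clamp_le//.
  by apply: clamp_mono; near: y; exact: nbhs_left_le.
apply: (@le_lt_trans _ _ (x - y)).
  by apply: clamp_lip; near: y; exact: nbhs_left_le.
by rewrite ltrBlDl -ltrBlDr; near: y; apply: nbhs_left_gt; rewrite ltrBlDr ltrDl.
Unshelve. all: by end_near. Qed.

Let nu := stieltjes setT W.

Let nu_itv c d : c <= d -> nu `[c, d[%classic = (W d - W c)%:E.
Proof.
move=> cd; have [] // := @stieltjesP R setT W openT _ W_nd W_lc.
by move=> _; exact.
Qed.

Let mab : measurable (`[a, b[%classic : set (measurableTypeR R)).
Proof. by []. Qed.

Let nu_ab_lty : (nu `[a, b[%classic < +oo)%E.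
Proof. by rewrite nu_itv// ltry. Qed.

Let nu_ab : {finite_measure set (measurableTypeR R) -> \bar R} := mfrestr mab nu_ab_lty.

(** A Lebesgue-null set lies in an open set of measure less than [d]. The components of that open
    set, cut down to [a, b[, are disjoint intervals of total length less than [d], so finitely many
    of them have [nu]-mass less than [e]; countable subadditivity does the rest. *)
Let nu_ab_dominated : nu_ab `<< lambda.
Proof.
apply/null_content_dominatesP => A mA A0.
apply/eqP; rewrite eq_le measure_ge0 andbT; apply/lee_addgt0Pr => e e0; rewrite add0e.
have [d d0 Hd] := acV e0.
have [|U [oU AU Ud]] := @lebesgue_regularity_outer R A d mA _ d0.
  by rewrite A0.
have mU : measurable (U : set (measurableTypeR R)) by exact: open_measurable.
have lU : (lambda U < d%:E)%E.
  have -> : U = A `|` (U `\` A) by rewrite setDUK.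
  by rewrite measureU ?A0 ?add0e//; [exact: measurableD|rewrite setDIK].
pose I := open_disjoint_itv oU.
pose J k := I k `&` `[a, b[%classic.
have mI k : measurable (I k : set (measurableTypeR R)).
  by apply: open_measurable; exact: open_disjoint_itv_open.
have mJ k : measurable (J k : set (measurableTypeR R)) by exact: measurableI.
(* The endpoints of the piece [J k] are its infimum and supremum; an empty piece gets the degenerate
   pair (a, a). *)
have exuv k : exists uv : R * R, [/\ a <= uv.1, uv.1 <= uv.2, uv.2 <= b,
   `]uv.1, uv.2[%classic `<=` J k & J k `<=` `[uv.1, uv.2[%classic].
  have [[x Jx]|J0] := pselect (J k !=set0); last first.
    exists (a, a); rewrite lexx ab set_itvoo0; split => // t Jt.
    by exfalso; apply: J0; exists t.
  have Jab t : J k t -> a <= t < b by move=> [_]; rewrite /= in_itv.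
  have infJ : has_inf (J k).
    by split; [exists x|exists a => t /Jab/andP[]].
  have supJ : has_sup (J k).
    by split; [exists x|exists b => t /Jab/andP[_ /ltW]].
  have ix : inf (J k) <= x by apply: ge_inf => //; exact: infJ.2.
  have xs : x <= sup (J k) by apply: ub_le_sup => //; exact: supJ.2.
  exists (inf (J k), sup (J k)) => /=; split.
  - by apply: lb_le_inf; [exists x|move=> t /Jab/andP[]].
  - exact: le_trans xs.
  - by apply: ge_sup; [exists x|move=> t /Jab/andP[_ /ltW]].
  - move=> t /=; rewrite in_itv/= => /andP[it ts].
    have [y Jy yt] := inf_lt infJ.1 it; have [z Jz tz] := sup_gt supJ.1 ts.
    split.
      apply: (open_disjoint_itv_is_interval Jy.1 Jz.1).
      by rewrite !ltW.
    rewrite /= in_itv/=; have /andP[ay _] := Jab _ Jy; have /andP[_ zb] := Jab _ Jz.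
    by rewrite (le_trans ay (ltW yt))/= (lt_trans tz zb).
  (* The supremum is not attained: the component is open and t < b, so [J k] also has points to the
     right of [t]. *)
  - move=> t Jt /=; rewrite in_itv/= ge_inf//=; last exact: infJ.2.
    have /andP[at_ tb] := Jab _ Jt.
    have It : \forall y \near t^'+, I k y.
      apply: cvg_within; apply: open_nbhs_nbhs; split; last by case: Jt.
      exact: open_disjoint_itv_open.
    near (t : R)^'+ => y.
    apply: (@lt_le_trans _ _ y); first by near: y; exact: nbhs_right_gt.
    apply: ub_le_sup; first exact: supJ.2.
    split; first by near: y.
    rewrite /= in_itv/=; apply/andP; split; last by near: y; exact: nbhs_right_lt.
    by rewrite (le_trans at_)//; near: y; exact: nbhs_right_ge.
have [uv Huv] := choice exuv.
have nuA : (nu_ab A <= \sum_(k <oo) nu (J k))%E.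
  apply: (@measure_sigma_subadditive _ _ _ nu (A `&` `[a, b[%classic) J) => //.
    exact: measurableI.
  move=> t [At abt]; have := AU _ At; rewrite (open_disjoint_itv_bigcup oU) => -[k _ Ikt].
  by exists k.
apply: (le_trans nuA); apply: lime_le; first exact: is_cvg_nneseries.
apply: nearW => n; rewrite big_mkord.
have uvab (i : 'I_n) : a <= (uv i).1 /\ (uv i).1 <= (uv i).2 /\ (uv i).2 <= b.
  by case: (Huv i).
have tuv : trivIset [set: 'I_n] (fun i => `](uv i).1, (uv i).2[%classic).
  move=> i j _ _ [t [ti tj]]; apply: val_inj.
  have tI : trivIset setT I by exact: open_disjoint_itv_trivIset.
  apply: (tI (val i) (val j)) => //; exists t.
  by split; [case: (Huv i) => _ _ _ /(_ _ ti)[]|case: (Huv j) => _ _ _ /(_ _ tj)[]].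
have suv : \sum_(i < n) ((uv i).2 - (uv i).1) < d.
  rewrite -lte_fin -sumEFin; apply: le_lt_trans lU.
  have lE (i : 'I_n) : ((uv i).2 - (uv i).1)%:E = lambda `](uv i).1, (uv i).2[%classic.
    rewrite lebesgue_measure_itv/= lte_fin; case: ltP => // h.
    by have [_ h' _ _ _] := Huv i; rewrite (le_anti (introT andP (conj h h'))) subrr.
  rewrite (eq_bigr _ (fun i _ => lE i)) -measure_bigsetU_ord//.
  apply: le_measure; rewrite ?inE//; first exact: bigsetU_measurable.
  apply: (big_ind (fun X => X `<=` U)) => //.
    by move=> X Y XU YU t [/XU|/YU].
  move=> i _ t ti; rewrite (open_disjoint_itv_bigcup oU); exists i => //.
  by case: (Huv i) => _ _ _ /(_ _ ti)[].
have := Hd n _ _ uvab tuv suv; rewrite -lte_fin -sumEFin => /ltW; apply: le_trans.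
apply: lee_sum => i _; have [au uvi vb _ Juv] := Huv i.
apply: (@le_trans _ _ (nu `[(uv i).1, (uv i).2[%classic)).
  by apply: le_measure; rewrite ?inE.
have u1 : a <= (uv i).1 <= b by rewrite au (le_trans uvi).
have u2 : a <= (uv i).2 <= b by rewrite vb (le_trans au).
by rewrite nu_itv// lee_fin /W/= !clamp_id// ler_norm.
Unshelve. all: by end_near. Qed.

Lemma monotone_abs_cont_density : exists2 p : R -> R,
  lambda.-integrable setT (EFin \o p) &
  forall c d, a <= c -> c <= d -> d <= b ->
    V d - V c = (\int[lambda]_(t in `[c, d[) p t)%R.
Proof.
have [p [p0 pfin ip pE]] := radon_nikodym_sigma_finite nu_ab_dominated.
have pfine : p = EFin \o (fine \o p) by apply/funext => t /=; rewrite fineK.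
exists (fine \o p); first by rewrite -pfine.
move=> c d ac cd db; apply: EFin_inj.
rewrite /Rintegral -[X in integral _ _ X]pfine -pE//= /mfrestr /mrestr setIidl.
  by rewrite nu_itv//= /W/= !clamp_id ?ac ?db ?(le_trans cd) ?(le_trans ac).
move=> t /=; rewrite !in_itv/= => /andP[ct td].
by rewrite (le_trans ac ct) (lt_le_trans td db).
Qed.


End monotone.
(** Jordan decomposition: g = V - (V - g), where the variation function [V] and V - g are both
    nondecreasing and absolutely continuous. Their densities [p] and [q] give h = p - q. *)
Lemma abs_cont_density a b g : a <= b -> abs_cont a b g ->
  exists h : R -> R, [/\ lambda.-integrable setT (EFin \o h),
    forall c d, a <= c -> c <= d -> d <= b ->
      g d - g c = (\int[lambda]_(t in `[c, d[) h t)%R &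
    {ae lambda, forall x, a < x < b -> derivable g x 1 /\ derive1 g x = h x}].
Proof.
move=> ab acg; pose V x := fine (total_variation a x g).
have acV : abs_cont a b V by exact: abs_cont_total_variation.
have acN := abs_contB acV acg.
have VE x y : a <= x -> x <= y -> y <= b -> (V y - V x)%:E = total_variation x y g.
  by move=> ax xy yb; exact: total_variation_sub acg ax xy yb.
have ndV : {in `[a, b] &, {homo V : x y / x <= y}}.
  move=> x y; rewrite !in_itv/= => /andP[ax xb] /andP[ay yb] xy.
  by rewrite -subr_ge0 -lee_fin VE// total_variation_ge0.
have ndN : {in `[a, b] &, {homo (fun x => V x - g x) : x y / x <= y}}.
  move=> x y; rewrite !in_itv/= => /andP[ax xb] /andP[ay yb] xy.
  have := total_variation_ge g xy; rewrite -VE// lee_fin.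
  by have := ler_norm (g y - g x); lra.
have [p ip pE] := monotone_abs_cont_density ab acV ndV.
have [q iq qE] := monotone_abs_cont_density ab acN ndN.
pose h x := p x - q x.
have ih : lambda.-integrable setT (EFin \o h) by exact: (integrableB measurableT ip iq).
have hE c d : a <= c -> c <= d -> d <= b -> g d - g c = (\int[lambda]_(t in `[c, d[) h t)%R.
  move=> ac cd db; rewrite RintegralB//; last 2 first.
  - exact: integrableS ip.
  - exact: integrableS iq.
  by rewrite -pE// -qE//; ring.
exists h; split => //.
have ihS (A : set R) : measurable A -> lambda.-integrable A (EFin \o h).
  by move=> mA; exact: integrableS ih.
pose F x := (\int[lambda]_(t in `]-oo, x]) h t)%R.
have loch : locally_integrable setT h.
  exact: open_integrable_locally openT ih.
have := FTC1Ny (fun y => ihS _ (measurable_itv _)) loch.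
apply: (@filterS _ _ (ae_filter_ringOfSetsType lambda)) => x [dF F'] /andP[ax xb].
(* Near an interior point [g] differs from the indefinite integral of [h] by a constant, so it
   inherits the almost everywhere derivative. *)
have gF : \forall y \near x, F y + (g a - F a) = g y.
  near=> y.
  have ay : a < y by near: y; exact: lt_nbhsr.
  have yb : y < b by near: y; exact: lt_nbhsl.
  have -> : g y = g a + (\int[lambda]_(t in `[a, y[) h t)%R.
    by rewrite -hE// ?ltW//; ring.
  rewrite Rintegral_itv_bndo_bndc; last exact: ihS.
  rewrite -Rintegral_itv_obnd_cbnd; last exact: ihS.
  rewrite -(@Rintegral_itvB _ h -oo%O (BRight y) a)//; first by rewrite /F; ring.
  - exact: ihS.
  - by rewrite bnd_simp ltW.
have dF' : is_derive x 1 (fun y => F y + (g a - F a)) (h x).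
  have dF1 : is_derive x 1 F (h x) by apply: DeriveDef => //; rewrite -derive1E.
  by have := is_deriveD dF1 (is_derive_cst (g a - F a) x 1); rewrite addr0.
have dg := near_eq_is_derive gF dF'.
by split; [exact: ex_derive|rewrite derive1E; exact: derive_val].
Unshelve. all: by end_near. Qed.

End absolutely_continuous_density.

(** * The density form of the identity *)

Section nonmeasurable_integrand.
Context d (T : measurableType d) (R : realType) (m : {measure set T -> \bar R}).
Local Open Scope ereal_scope.

Lemma ge0_le_integral_nonmeasurable (f g : T -> \bar R) :
  (forall x, 0 <= f x) -> (forall x, f x <= g x) ->
  \int[m]_x f x <= \int[m]_x g x.
Proof.
move=> f0 fg; have g0 x : 0 <= g x by exact: le_trans (f0 x) (fg x).
rewrite !ge0_integralTE//; apply: le_ereal_sup => _ [h hf <-]; exists h => // x.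
exact: le_trans (hf x) (fg x).
Qed.

(* The integral is defined for every function, so that only one side has to be
   measurable: squeeze f between measurable functions that differ on N only. *)
Lemma ge0_integral_eq_off_null (f g : T -> \bar R) (N : set T) :
  measurable N -> m N = 0 -> measurable_fun setT g ->
  (forall x, 0 <= f x) -> (forall x, 0 <= g x) -> (forall x, ~ N x -> f x = g x) ->
  \int[m]_x f x = \int[m]_x g x.
Proof.
move=> mN N0 mg f0 g0 fg.
(* On [N] the function [g1] is 0 and [g2] is +oo; off [N] both equal [g]. Hence g1 <= f <= g2
   everywhere. *)
pose g1 x := g x * (\1_(~` N) x)%:E; pose g2 x := g x + +oo * (\1_N x)%:E.
have mC : measurable (~` N) by exact: measurableC.
have mg1 : measurable_fun setT g1.
  by apply: emeasurable_funM => //; exact/measurable_EFinP/measurable_indic.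
have mg2 : measurable_fun setT g2.
  apply: emeasurable_funD => //; apply: emeasurable_funM => //.
  exact/measurable_EFinP/measurable_indic.
have g10 x : 0 <= g1 x by rewrite mule_ge0// lee_fin.
have g20 x : 0 <= g2 x by rewrite adde_ge0// mule_ge0// lee_fin.
have ->: \int[m]_x g x = \int[m]_x g1 x.
  apply: ge0_ae_eq_integral => //; exists N; split => // x /=.
  apply: contra_notP => Nx _; rewrite /g1 indicE mem_set ?mule1//.
apply/eqP; rewrite eq_le; apply/andP; split.
  have -> : \int[m]_x g1 x = \int[m]_x g2 x.
    apply: ge0_ae_eq_integral => //; exists N; split => // x /=.
    apply: contra_notP => Nx _.
    by rewrite /g1 /g2 !indicE mem_set// memNset// mule1 mule0 adde0.
  apply: ge0_le_integral_nonmeasurable => // x; rewrite /g2 indicE.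
  have [Nx|Nx] := pselect (N x); last by rewrite memNset// mule0 adde0 fg.
  by rewrite mem_set// mule1 addey ?leey// gt_eqF// (lt_le_trans _ (g0 x))// ltNy0.
apply: ge0_le_integral_nonmeasurable => // x; rewrite /g1 indicE.
have [Nx|Nx] := pselect (N x); last by rewrite mem_set// mule1 fg.
by rewrite memNset ?mule0// => /(_ Nx).
Qed.

Lemma integral_eq_off_null (f g : T -> \bar R) (N : set T) :
  measurable N -> m N = 0 -> measurable_fun setT g ->
  (forall x, ~ N x -> f x = g x) -> \int[m]_x f x = \int[m]_x g x.
Proof.
move=> mN N0 mg fg; rewrite integralE [RHS]integralE; congr (_ - _).
- apply: (ge0_integral_eq_off_null mN N0) => //; first exact: measurable_funepos.
  by move=> x Nx; rewrite !funeposE fg.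
- apply: (ge0_integral_eq_off_null mN N0) => //; first exact: measurable_funeneg.
  by move=> x Nx; rewrite !funenegE fg.
Qed.

End nonmeasurable_integrand.

(* Elsewhere derive1 g is a junk value, so it is replaced by a measurable k. *)
Lemma limsup_difference_quotient (R : realType) (g : R -> R) :
  measurable_fun (setT : set (measurableTypeR R)) (g : measurableTypeR R -> R) ->
  exists2 k : R -> R, measurable_fun (setT : set (measurableTypeR R)) (k : measurableTypeR R -> R) &
    forall y, derivable g y 1 -> derive1 g y = k y.
Proof.
(* Difference quotients with step 1 / (n + 1): their upper limit is measurable, and equals the
   derivative wherever that exists. *)
move=> mg; pose q (n : nat) (y : measurableTypeR R) : \bar R :=
  (n.+1%:R * (g (y + n.+1%:R^-1) - g y))%:E.
exists (fine \o (fun y => limn_esup (q ^~ y))).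
  apply: measurableT_comp => //; apply: measurable_fun_limn_esup => n.
  apply/measurable_EFinP; apply: measurable_funM => //; apply: measurable_funB => //.
  by apply: (measurableT_comp mg); exact: measurable_funD.
move=> y dg /=.
have dq : h^-1 *: (g (h + y) - g y) @[h --> (0 : R)^'] --> derive1 g y.
  apply: cvg_toP => //; have := dg; rewrite /derivable.
  by under eq_fun do rewrite [_ *: 1]mulr1.
have qy : q ^~ y @ \oo --> (derive1 g y)%:E.
  apply: cvg_EFin; first exact: nearW.
  have dqr := cvg_dnbhs_at_right dq.
  have := (cvg_at_rightP _ _ _).1 dqr (@harmonic R) (conj _ cvg_harmonic).
  rewrite /harmonic /q /= => h.
  apply: cvg_trans (h _) => // {h}.
  apply: near_eq_cvg; apply: nearW => n /=. by rewrite invrK (addrC y).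
by rewrite (cvg_limn_einf_sup qy).
Qed.

Section density_covariance.
Context {R : realType} (mu : probability (measurableTypeR R) R) (f : R -> R).
Hypotheses (f_ge0 : forall x, 0 <= f x) (f_cont : continuous f)
  (f_density : has_density mu f).

Let D := [set x | 0 < f x].
Hypothesis iD : is_interval D.
Local Notation F := (distr_fun mu).
Let c x z := (z <= x)%R%:R - F x.

(** As [D] is an interval, all the mass lies on one side of [y], so F(y) is 0 or 1 and the kernel
    vanishes. This neutralizes the values of the derivative of [g] outside [D]. *)
Lemma Kmu_off_positivity x y : ~ D y -> Kmu mu x y = 0.
Proof.
move=> nDy; have mID := measure_positivityI f_ge0 f_cont f_density.
have [[t Dt yt]|nDr] := pselect (exists2 t, D t & y < t).
  have Fy0 : F y = 0.
    rewrite /distr_fun -mID// (_ : _ `&` _ = set0) ?measure0//.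
    rewrite -subset0 => s [/=]; rewrite in_itv/= => sy Ds.
    by apply: nDy; apply: (iD Ds Dt); rewrite sy ltW.
  rewrite /Kmu Fy0 mulr0 subr0; apply/le_anti; rewrite distr_fun_ge0 andbT.
  by rewrite -Fy0 distr_fun_le// ge_min lexx orbT.
have Fy1 z : y <= z -> F z = 1.
  move=> yz; rewrite /distr_fun -mID// (_ : _ `&` _ = D).
    by rewrite (density_on_positivity f_ge0 f_cont f_density).
  apply/setIidPr => s Ds /=; rewrite in_itv/= (le_trans _ yz)// leNgt.
  by apply/negP => ys; apply: nDr; exists s.
rewrite /Kmu (Fy1 y)// mulr1; have [xy|yx] := leP x y; first by rewrite subrr.
by rewrite (Fy1 y)// (Fy1 x) ?subrr// ltW.
Qed.

Variable g : R -> R.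
Hypothesis ig : mu.-integrable setT (EFin \o (g \_ D)).

Let igS (A : set (measurableTypeR R)) : measurable A -> mu.-integrable A (EFin \o (g \_ D)).
Proof. by move=> mA; exact: integrableS ig. Qed.

(* Otherwise |g| > e / mu A on A `&` D, which has full mass in A. *)
Let charged_tail (A : set (measurableTypeR R)) (e : R) : measurable A -> 0 < e -> 0 < fine (mu A) ->
  (\int[mu]_(x in A) `|(g \_ D) x| < e)%R ->
  exists2 z, D z & A z /\ `|g z| * fine (mu A) <= e.
Proof.
move=> mA e0 A0; apply: contraPP => H; apply/negP; rewrite -leNgt.
have mAD : measurable (A `&` D : set (measurableTypeR R)).
  by apply: measurableI => //; exact: positivity_measurable.
apply: le_trans (le_Rintegral_subset mAD mA _ (igS mA)); last exact: subIsetl.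
have -> : e = (\int[mu]_(x in A `&` D) cst (e / fine (mu A)) x)%R.
  rewrite Rintegral_cst// [X in _ * fine X](_ : _ = mu A).
    by rewrite divfK// gt_eqF.
  exact: (measure_positivityI f_ge0 f_cont f_density mA).
apply: le_Rintegral => //.
- exact: finite_measure_integrable_cst.
- by apply: integrable_norm; exact: igS.
- move=> z [Az Dz]; rewrite patchE mem_set// ler_pdivrMr// leNgt; apply/negP => /ltW gz.
  by apply: H; exists z.
Qed.

(** [charged_tail] bounds |g z| times the mass of a tail that contains [z]; the tail beyond [z] is
    contained in it and has no more mass. *)
Lemma positivity_good_right (e b : R) : 0 < e -> D b ->
  exists2 z, D z & b <= z /\ `|g z| * fine (mu `]z, +oo[%classic) <= e.
Proof.
move=> e0 Db.
have oD := positivity_open f_cont.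
have [n c' Dc|u [ndu Du bu uD]] := open_cofinal_seq (Q := fun=> [set z | b <= z]) oD (ex_intro _ _ Db).
  by exists (Num.max b c'); [rewrite /Num.max; case: ifP|rewrite /= !le_max !lexx !orbT].
have mA n : measurable (`]u n, +oo[%classic : set (measurableTypeR R)) by [].
have [||N _ HN] := tail_integral_lt f_ge0 f_cont f_density ig mA _ _ e0.
- by move=> m n mn t /=; rewrite !in_itv/= !andbT; apply: le_lt_trans; exact: ndu.
- by move=> z /uD[n un]; exists n; rewrite /= in_itv/= andbT ltNge (ltW un).
have [z Dz [uz gz]] := charged_tail (mA N) e0
  (positivity_charged_right f_ge0 f_cont f_density (Du N)) (HN N (leqnn N)).
exists z => //; move: uz; rewrite /= in_itv/= andbT => uz.
split; first by rewrite (le_trans (bu N))// ltW.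
apply: le_trans gz; rewrite ler_wpM2l// fine_le ?fin_num_measure// le_measure ?inE//.
by apply: subset_itvr; rewrite bnd_simp ltW.
Qed.

Lemma positivity_good_left (e b : R) : 0 < e -> D b ->
  exists2 z, D z & z <= b /\ `|g z| * fine (mu `]-oo, z]%classic) <= e.
Proof.
move=> e0 Db.
have oD := positivity_open f_cont.
have [n c' Dc|u [ndu Du bu uD]] := open_coinitial_seq (Q := fun=> [set z | z <= b]) oD (ex_intro _ _ Db).
  by exists (Num.min b c'); [rewrite /Num.min; case: ifP|rewrite /= !ge_min !lexx !orbT].
have mA n : measurable (`]-oo, u n]%classic : set (measurableTypeR R)) by [].
have [||N _ HN] := tail_integral_lt f_ge0 f_cont f_density ig mA _ _ e0.
- by move=> m n mn t /=; rewrite !in_itv/= => /le_trans; apply; exact: ndu.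
- by move=> z /uD[n un]; exists n; rewrite /= in_itv/= leNgt un.
have [z Dz [uz gz]] := charged_tail (mA N) e0
  (positivity_charged_left f_ge0 f_cont f_density (Du N)) (HN N (leqnn N)).
exists z => //; move: uz; rewrite /= in_itv/= => uz.
split; first by rewrite (le_trans uz)// bu.
apply: le_trans gz; rewrite ler_wpM2l// fine_le ?fin_num_measure// le_measure ?inE//.
by apply: subset_itvl; rewrite bnd_simp.
Qed.

(** The difference [dl] vanishes on []a n, b n]]. On the left tail it is at most |g| + |g (a n)|,
    whose integral is a tail integral of |g|, eventually below e / 4, plus |g (a n)| F(a n), which
    the choice of [a n] makes at most 1 / (n + 1); the right tail is alike. *)
Lemma clamp_integral_cvg (a b : R^nat) x :
  (forall m n, (m <= n)%N -> a n <= a m) -> {homo b : m n / (m <= n)%N >-> m <= n} ->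
  (forall n, D (a n)) -> (forall n, D (b n)) -> (forall n, a n <= b n) ->
  (forall z, D z -> exists n, a n < z) -> (forall z, D z -> exists n, z < b n) ->
  (forall n, `|g (a n)| * fine (mu `]-oo, a n]%classic) <= n.+1%:R^-1) ->
  (forall n, `|g (b n)| * fine (mu `]b n, +oo[%classic) <= n.+1%:R^-1) ->
  (forall n, mu.-integrable setT (EFin \o (g \o clamp (a n) (b n)))) ->
  (\int[mu]_z (c x z * g (clamp (a n) (b n) z)))%R @[n --> \oo] -->
  (\int[mu]_z (c x z * (g \_ D) z))%R.
Proof.
move=> nia ndb Da Db ab aD bD ga gb igc.
have icM k (A : set (measurableTypeR R)) : measurable A -> mu.-integrable setT (EFin \o k) ->
    mu.-integrable A (EFin \o (fun z => c x z * k z)).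
  by move=> mA ik; apply: (integrableS measurableT) => //; exact: integrable_centeredM.
have mA n : measurable (`]-oo, a n]%classic : set (measurableTypeR R)) by [].
have mB n : measurable (`]b n, +oo[%classic : set (measurableTypeR R)) by [].
apply/cvgrPdist_lt => e e0; have e4 : 0 < e / 4 by rewrite divr_gt0.
have [||N1 _ HN1] := tail_integral_lt f_ge0 f_cont f_density ig mA _ _ e4.
- by move=> m n mn t /=; rewrite !in_itv/= => /le_trans; apply; exact: nia.
- by move=> z /aD[n un]; exists n; rewrite /= in_itv/= leNgt un.
have [||N2 _ HN2] := tail_integral_lt f_ge0 f_cont f_density ig mB _ _ e4.
- by move=> m n mn t /=; rewrite !in_itv/= !andbT; apply: le_lt_trans; exact: ndb.
- by move=> z /bD[n un]; exists n; rewrite /= in_itv/= andbT ltNge (ltW un).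
have [N3 _ HN3] := near_infty_natSinv_lt (PosNum e4).
exists (maxn N1 (maxn N2 N3)) => // n /=; rewrite !geq_max => /and3P[n1 n2 n3].
have tA := HN1 n n1; have tB := HN2 n n2.
have tn : n.+1%:R^-1 < e / 4 by exact: HN3 n n3.
pose dl z := (g \_ D) z - g (clamp (a n) (b n) z).
have idl : mu.-integrable setT (EFin \o dl) by exact: (integrableB measurableT ig (igc n)).
rewrite -RintegralB//; [|exact: icM|exact: (icM (g \o clamp (a n) (b n)))].
rewrite (_ : (\int[mu]_z _)%R = (\int[mu]_z (c x z * dl z))%R); last first.
  by apply: eq_Rintegral => z _; rewrite /dl; ring.
have bound (A : set (measurableTypeR R)) k : measurable A -> (forall z, A z -> clamp (a n) (b n) z = k) ->
    `|g k| * fine (mu A) <= n.+1%:R^-1 -> (\int[mu]_(z in A) `|(g \_ D) z| < e / 4)%R ->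
    `|\int[mu]_(z in A) (c x z * dl z)| < e / 2.
  move=> mA' Ak gk tA'.
  apply: (le_lt_trans (le_normr_Rintegral _ (icM _ _ _ idl))) => //.
  have inD : mu.-integrable A (EFin \o (fun z => `|(g \_ D) z|)).
    by apply: integrable_norm; exact: igS.
  have icst : mu.-integrable A (EFin \o cst `|g k|) by exact: finite_measure_integrable_cst.
  apply: (@le_lt_trans _ _ (\int[mu]_(z in A) (`|(g \_ D) z| + cst `|g k| z))%R).
    apply: le_Rintegral => //.
    - by apply: integrable_norm; exact: icM.
    - exact: (integrableD mA' inD icst).
    - move=> z Az; rewrite normrM; apply: (@le_trans _ _ `|dl z|).
        by rewrite ler_piMl// normr_centered_le1.
      by rewrite /dl (Ak _ Az) ler_normB.
  have cE : (\int[mu]_(z in A) cst `|g k| z)%R = `|g k| * fine (mu A) by rewrite Rintegral_cst.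
  rewrite RintegralD// cE.
  by apply: (lt_le_trans (ltr_leD tA' (le_trans gk (ltW tn)))); lra.
have setTE : [set: R] = `]-oo, a n] `|` (`]a n, b n] `|` `]b n, +oo[).
  by rewrite -!itv_bndbnd_setU ?set_itvNyy ?bnd_simp.
rewrite setTE Rintegral_setU//; last 3 first.
- by exact: measurableU.
- by apply: icM => //; apply: measurableU => //; exact: measurableU.
- apply/disj_setPLR => t /=; rewrite !in_itv/= => ta [].
    by rewrite ltNge ta.
  by rewrite andbT ltNge (le_trans ta).
rewrite Rintegral_setU//; last 2 first.
- by apply: icM => //; exact: measurableU.
- by apply/disj_setPLR => t /=; rewrite !in_itv/= andbT => /andP[_ tb]; apply/negP; rewrite -leNgt.
rewrite [X in _ + (X + _)](_ : _ = 0); last first.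
  rewrite /Rintegral integral0_eq// => z /=; rewrite in_itv/= => /andP[az zb].
  have Dz : D z by apply: (iD (Da n) (Db n)); rewrite (ltW az).
  by rewrite /dl patchE mem_set// clamp_id ?(ltW az)// subrr mulr0.
rewrite add0r; apply: (le_lt_trans (ler_normD _ _)).
rewrite [ltRHS](_ : e = e / 2 + e / 2); last by field.
apply: ltrD.
- apply: (bound _ (a n)) => // z /=; rewrite in_itv/= => za.
  by rewrite /clamp min_l ?max_l// (le_trans za).
- apply: (bound _ (b n)) => // z /=; rewrite in_itv/= andbT => bz.
  by rewrite /clamp min_r ?max_r// ltW.
Qed.

End density_covariance.

Section density_covariance_identity.
Context {R : realType} (mu : probability (measurableTypeR R) R) (f : R -> R).
Hypotheses (f_ge0 : forall x, 0 <= f x) (f_cont : continuous f)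
  (f_density : has_density mu f).

Let D := [set x | 0 < f x].
Hypothesis iD : is_interval D.
Local Notation F := (distr_fun mu).
Local Notation lambda := (@lebesgue_measure R).

Lemma abs_cont_clamp_continuous (g : R -> R) a b : a <= b -> abs_cont a b g ->
  continuous (g \o clamp a b).
Proof.
move=> ab acg x; apply/cvgrPdist_lt => e e0.
have [d d0 Hd] := abs_cont_modulus acg e0; exists d => //= y; rewrite /ball_ /= => xyd.
have [xy|/ltW yx] := leP x y.
  rewrite distrC; apply: Hd; rewrite ?clamp_ge ?clamp_le ?clamp_mono//.
  by apply: (le_lt_trans (clamp_lip a b xy)); rewrite -[ltLHS]ger0_norm ?subr_ge0// distrC.
apply: Hd; rewrite ?clamp_ge ?clamp_le ?clamp_mono//.
by apply: (le_lt_trans (clamp_lip a b yx)); rewrite -[ltLHS]ger0_norm ?subr_ge0.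
Qed.

Lemma density_covariance_itv (g h : R -> R) a b x : a <= b -> abs_cont a b g ->
  lambda.-integrable setT (EFin \o h) ->
  (forall c d, a <= c -> c <= d -> d <= b -> g d - g c = (\int[lambda]_(t in `[c, d[) h t)%R) ->
  mu.-integrable setT (EFin \o (g \o clamp a b)) /\
  (\int[lambda]_(y in `[a, b[) (Kmu mu x y * h y)%:E =
   (- \int[mu]_z (((z <= x)%R%:R - F x) * g (clamp a b z)))%R%:E)%E.
Proof.
move=> ab acg ih hE.
have mE : measurable (`[a, b[%classic : set (measurableTypeR R)) by [].
pose hE' := h \_ `[a, b[%classic.
have ihE : lambda.-integrable setT (EFin \o hE').
  by rewrite -restrict_EFin -integrable_mkcond//; exact: integrableS ih.
have hG z : (\int[lambda]_(y in `[z, +oo[) hE' y)%R = g b - g (clamp a b z).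
  rewrite -Rintegral_mkcondr clamp_itvco// hE ?clamp_ge ?clamp_le//.
have gE z : g (clamp a b z) = g b - (\int[lambda]_(y in `[z, +oo[) hE' y)%R.
  by rewrite hG; ring.
have igc : mu.-integrable setT (EFin \o (g \o clamp a b)).
  apply: measurable_bounded_integrable => //.
  - by rewrite (le_lt_trans (probability_le1 mu _)) ?ltry.
  - by apply: continuous_measurable_fun; exact: abs_cont_clamp_continuous.
  - exists (`|g b| + (\int[lambda]_y `|hE' y|)%R); split; first exact: num_real.
    move=> M M1 z _ /=; rewrite (le_trans _ (ltW M1))// gE; apply: (le_trans (ler_normB _ _)); rewrite lerD2l.
    have ihz : lambda.-integrable `[z, +oo[ (EFin \o hE') by exact: integrableS ihE.
    by apply: (le_trans (le_normr_Rintegral _ ihz)) => //; apply: le_Rintegral_subset.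
split => //.
rewrite -(@covariance_clamp _ _ lambda hE' g)//; last exact: sigma_finiteT.
rewrite [LHS]integral_mkcond; apply: eq_integral => y _.
by rewrite /hE' !patchE; case: ifP; rewrite ?mulr0.
Qed.

(** The integrand may change sign and need not be absolutely integrable. The integrals of its
    positive and negative parts over [a n, b n[ converge monotonically, and [has_integral] keeps the
    difference of the limits from being of the form +oo - +oo. *)
Lemma density_covariance (g : R -> R) x :
  mu.-integrable setT (EFin \o (g \_ D)) -> loc_abs_cont D g ->
  has_integral (fun y => (Kmu mu x y * derive1 g y)%:E) ->
  (\int[lambda]_y (Kmu mu x y * derive1 g y)%:E =
   (- \int[mu]_z (((z <= x)%R%:R - F x) * (g \_ D) z))%R%:E)%E.
Proof.
move=> ig acg hi.
have oD := positivity_open f_cont.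
have D0 := positivity_nonempty f_ge0 f_cont f_density.
have Qa (n : nat) b : D b -> exists2 z, D z &
    z <= b /\ [set z | `|g z| * fine (mu `]-oo, z]%classic) <= n.+1%:R^-1] z.
  have n0 : (0 : R) < n.+1%:R^-1 by rewrite invr_gt0.
  have := positivity_good_left f_ge0 f_cont f_density ig n0; apply.
have [a [nia Da ga aD]] := open_coinitial_seq oD D0 Qa.
have [n c Dc|e [_ De _ eD]] := open_cofinal_seq (Q := fun=> setT) oD D0; first by exists c.
have [m am] := eD _ (Da 0%N).
(* Beyond the tail bound, every right endpoint must exceed [a 0], so that a n < b n for all n. *)
have Qb (n : nat) b : D b -> exists2 z, D z &
    b <= z /\ [set z | a 0%N < z /\ `|g z| * fine (mu `]z, +oo[%classic) <= n.+1%:R^-1] z.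
  move=> Db; have Dmax : D (Num.max b (e m)) by rewrite /Num.max; case: ifP => _; [exact: De|exact: Db].
  have n0 : (0 : R) < n.+1%:R^-1 by rewrite invr_gt0.
  have [z Dz [+ gz]] := positivity_good_right f_ge0 f_cont f_density ig n0 Dmax.
  by rewrite ge_max => /andP[bz emz]; exists z => //; split => //; split => //; exact: lt_le_trans am emz.
have [b [ndb Db gb bD]] := open_cofinal_seq oD D0 Qb.
have lab n : a n < b n.
  by have [ab _] := gb n; exact: le_lt_trans (nia 0%N n (leq0n n)) ab.
have Dab n t : a n <= t <= b n -> D t by exact: (iD (Da n) (Db n)).
have acgn n : abs_cont (a n) (b n) g.
  by apply: acg => t /=; rewrite in_itv/=; exact: Dab.
have exh n : exists h : R -> R, [/\ lambda.-integrable setT (EFin \o h),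
    forall c d, a n <= c -> c <= d -> d <= b n ->
      g d - g c = (\int[lambda]_(t in `[c, d[) h t)%R &
    {ae lambda, forall y, a n < y < b n -> derivable g y 1 /\ derive1 g y = h y}].
  apply: abs_cont_density; first exact: ltW.
  exact: acgn.
have [h Hh] := choice exh.
(* Absolute continuity is only available on compact intervals, so there is one density [h n] for
   each n; countably many exceptional sets merge into one null set. *)
have [N [mN N0 subN]] : {ae lambda, forall y, forall n, a n < y < b n ->
    derivable g y 1 /\ derive1 g y = h n y}.
  by apply: ae_foralln => n; case: (Hh n).
have Ngood y : ~ N y -> forall n, a n < y < b n -> derivable g y 1 /\ derive1 g y = h n y.
  by move=> Ny; apply: contrapT => H; apply: Ny; exact: subN.
have mgD : measurable_fun setT (g \_ D : measurableTypeR R -> R).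
  by apply/measurable_EFinP; exact: measurable_int ig.
(* Integrability makes the restriction of [g] to [D] measurable, while [g] is unconstrained
   elsewhere. On the open set [D] both have the same derivative. *)
have [k mk dk] := limsup_difference_quotient mgD.
have gDnear y : D y -> \forall z \near y, g z = (g \_ D) z.
  move=> Dy; have : \forall z \near y, D z by exact: open_nbhs_nbhs.
  by apply: filterS => z Dz; rewrite patchE mem_set.
have exn y : D y -> exists n, a n < y < b n.
  move=> Dy; have [i ai] := aD _ Dy; have [j bj] := bD _ Dy; exists (maxn i j).
  rewrite (le_lt_trans _ ai) ?nia ?leq_maxl//=.
  by rewrite (lt_le_trans bj)// ndb// leq_maxr.
have kE y : D y -> ~ N y -> derive1 g y = k y.
  move=> Dy Ny; have [n yn] := exn _ Dy; have [dg _] := Ngood _ Ny _ yn.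
  rewrite -dk; last exact: near_eq_derivable (gDnear _ Dy) dg.
  by rewrite !derive1E (near_eq_derive _ (gDnear _ Dy)).
pose u y := (Kmu mu x y * derive1 g y)%:E.
pose v (y : measurableTypeR R) := (Kmu mu x y * k y)%:E.
have mv : measurable_fun setT v.
  by apply/measurable_EFinP; apply: measurable_funM => //; exact: measurable_Kmu.
have uv y : ~ N y -> u y = v y.
  move=> Ny; rewrite /u /v; have [Dy|nDy] := pselect (D y); first by rewrite kE.
  by rewrite (Kmu_off_positivity f_ge0 f_cont f_density)// !mul0r.
have -> : (\int[lambda]_y (Kmu mu x y * derive1 g y)%:E = \int[lambda]_y v y)%E.
  exact: (integral_eq_off_null mN N0 mv uv).
have hv : ((\int[lambda]_y v^\+ y < +oo) \/ (\int[lambda]_y v^\- y < +oo))%E.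
  case: hi => hi; [left|right].
  - rewrite -(@ge0_integral_eq_off_null _ _ _ lambda u^\+%E _ N mN N0)//.
      exact: measurable_funepos.
    by move=> y Ny; rewrite !funeposE uv.
  - rewrite -(@ge0_integral_eq_off_null _ _ _ lambda u^\-%E _ N mN N0)//.
      exact: measurable_funeneg.
    by move=> y Ny; rewrite !funenegE uv.
pose E n := `[a n, b n[%classic : set (measurableTypeR R).
have mE n : measurable (E n) by exact: measurable_itv.
pose r n := (- \int[mu]_z (((z <= x)%R%:R - F x) * g (clamp (a n) (b n) z)))%R.
have ihn n : lambda.-integrable setT (EFin \o h n) by case: (Hh n).
have hEn n : forall c d, a n <= c -> c <= d -> d <= b n ->
  g d - g c = (\int[lambda]_(t in `[c, d[) h n t)%R by case: (Hh n).
have Hitv n := density_covariance_itv x (ltW (lab n)) (acgn n) (ihn n) (hEn n).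
have igc n : mu.-integrable setT (EFin \o (g \o clamp (a n) (b n))) by case: (Hitv n).
have vE n : (\int[lambda]_(y in E n) v y = (r n)%:E)%E.
  rewrite /r; have [_ <-] := Hitv n.
  have mh : measurable_fun setT (h n : measurableTypeR R -> R).
    by apply/measurable_EFinP; exact: measurable_int (ihn n).
  apply: ae_eq_integral => //; first exact: measurable_funTS.
    apply: measurable_funTS; apply/measurable_EFinP; apply: measurable_funM => //.
    exact: measurable_Kmu.
  (* The derivative is known on the open interval only, so the endpoint [a n] of [a n, b n[ joins
     the null set. *)
  exists (N `|` [set a n]); split; first exact: measurableU.
    by rewrite measureU0//; exact: lebesgue_measure_set1.
  move=> y /= /not_implyP[+ H]; rewrite /E/= in_itv/= le_eqVlt => /andP[/predU1P[<-|ay] yb]; first by right.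
  left; apply: contrapT => Ny; apply: H; rewrite -(uv _ Ny) /u.
  by have [_ ->] := Ngood _ Ny n (introT andP (conj ay yb)).
have EDcvg w : measurable_fun setT w -> (forall y, (0 <= w y)%E) -> (forall y, ~ D y -> w y = 0%E) ->
    (\int[lambda]_(y in E n) w y)%E @[n --> \oo] --> (\int[lambda]_y w y)%E.
  move=> mw w0 wD.
  have -> : (\int[lambda]_y w y = \int[lambda]_(y in \bigcup_n E n) w y)%E.
    rewrite [RHS]integral_mkcond; apply: eq_integral => y _; rewrite patchE.
    case: ifPn => // /negP nE; apply: wD => Dy; apply: nE; rewrite inE.
    have [n /andP[ay yb]] := exn _ Dy; have Eny : E n y by rewrite /E/= in_itv/= (ltW ay).
    by exists n.
  apply: ge0_nondecreasing_set_cvg_integral => //.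
  - move=> i j ij; apply/subsetPset => t /=; rewrite /E/= !in_itv/= => /andP[at_ tb].
    by rewrite (le_trans (nia _ _ ij) at_)/= (lt_le_trans tb)// ndb.
  - by move=> n; exact: measurable_funTS.
have v0 y : ~ D y -> v y = 0%E.
  by move=> Dy; rewrite /v (Kmu_off_positivity f_ge0 f_cont f_density)// mul0r.
have cvgp : (\int[lambda]_(y in E n) v^\+ y)%E @[n --> \oo] --> (\int[lambda]_y v^\+ y)%E.
  apply: EDcvg; first exact: measurable_funepos.
    exact: funepos_ge0.
  by move=> y Dy; rewrite funeposE v0// maxxx.
have cvgn : (\int[lambda]_(y in E n) v^\- y)%E @[n --> \oo] --> (\int[lambda]_y v^\- y)%E.
  apply: EDcvg; first exact: measurable_funeneg.
    exact: funeneg_ge0.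
  by move=> y Dy; rewrite funenegE v0// oppe0 maxxx.
have p0 : (0 <= \int[lambda]_y v^\+ y)%E by apply: integral_ge0 => y _; exact: funepos_ge0.
have n0 : (0 <= \int[lambda]_y v^\- y)%E by apply: integral_ge0 => y _; exact: funeneg_ge0.
have adef : ((\int[lambda]_y v^\+ y) +? - (\int[lambda]_y v^\- y))%E.
  case: hv => hv; [apply: fin_num_adde_defr|apply: fin_num_adde_defl].
    by rewrite ge0_fin_numE.
  by rewrite fin_numN ge0_fin_numE.
have cvgv := cvgeB adef cvgp cvgn.
rewrite -integralE in cvgv.
have cvgr : (r n)%:E @[n --> \oo] --> (\int[lambda]_y v y)%E.
  rewrite (_ : (fun n => (r n)%:E) = (fun n => (\int[lambda]_(y in E n) v^\+ y) -
      (\int[lambda]_(y in E n) v^\- y))%E); first exact: cvgv.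
  by apply/funext => n; rewrite -integralE vE.
apply: (cvg_unique (@ereal_hausdorff R) cvgr).
apply: cvg_EFin; first exact: nearW.
apply: cvgN; apply: (clamp_integral_cvg f_ge0 f_cont f_density) => //.
- by move=> n; exact: ltW.
- by move=> n; case: (gb n).
Qed.

End density_covariance_identity.

(** * Convex functions *)

Section left_derivative_exp.
Context {R : realType}.

(** The lower bound is exp d >= 1 + d. The upper one comes from exp (- d) >= 1 - d, that is exp d <=
    1 / (1 - d), where 1 - d >= 1 / 2. *)
Lemma expR_second_order (d : R) : `|d| <= 2^-1 -> `|expR d - 1 - d| <= 2 * d ^+ 2.
Proof.
rewrite ler_norml => /andP[d1 d2].
have h1 := expR_ge1Dx d; have h2 := expR_ge1Dx (- d); have h3 := expR_gt0 d.
have h4 : expR d * (1 - d) <= 1 by rewrite -[leRHS](expRxMexpNx_1 d) ler_wpM2l// ltW.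
rewrite ler_norml; apply/andP; split; first by nra.
by nra.
Qed.

(** A one-sided chain rule. With [d] the increment of - c and [q] the difference quotient of [c],
    the remainder (exp d - 1 - d) / h is at most 2 |d| |q| in modulus, where [d] tends to 0 and [q]
    converges. *)
Lemma is_lderive_expN (c f : R -> R) (x l : R) :
  (\forall y \near x, f y = expR (- c y)) -> is_lderive c x l ->
  is_lderive f x (- (l * f x)).
Proof.
move=> fc dc; pose q h := h^-1 * (c (x + h) - c x).
have qh : q h @[h --> (0 : R)^'-] --> l by exact: dc.
pose d h := - (h * q h).
have hid : h @[h --> (0 : R)^'-] --> (0 : R) by apply: cvg_at_left_filter; exact: cvg_id.
have d0 : d h @[h --> (0 : R)^'-] --> (0 : R).
  by have := cvgN (cvgM hid qh); rewrite mul0r oppr0; exact.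
have r0 : (expR (d h) - 1 - d h) / h @[h --> (0 : R)^'-] --> (0 : R).
  apply/norm_cvg0P; apply: (@squeeze_cvgr _ _ _ _ (fun=> 0) (fun h => 2 * (`|d h| * `|q h|))).
  - near=> h; have h0 : h < 0 by near: h; exact: nbhs_left_lt.
    have dh : `|d h| <= 2^-1.
      near: h; have /cvgr0Pnorm_le := d0; apply; by rewrite invr_gt0.
    rewrite normr_ge0/= normrM normfV ler_pdivrMr ?normr_gt0 ?lt_eqF//.
    apply: (le_trans (expR_second_order dh)).
    rewrite -mulrA -mulrA -normrM [q h * h]mulrC -[`|h * q h|]normrN -/(d h).
    by rewrite -expr2 real_normK// num_real.
  - exact: cvg_cst.
  - have := cvgM (cvg_cst (2 : R)) (cvgM (cvg_norm d0) (cvg_norm qh)).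
    by rewrite normr0 mul0r mulr0; exact.
have fx : f x = expR (- c x) by exact: (nbhs_singleton fc).
have fch : \forall h \near (0 : R)^'-, f (x + h) = expR (- c (x + h)).
  case: fc => e /= e0 He; exists e => //= h; rewrite /ball_ /= sub0r normrN => he _.
  by apply: He; rewrite /ball_/= opprD addrA subrr sub0r normrN.
rewrite /is_lderive (_ : - (l * f x) = f x * (- l + 0)); last by ring.
have : f x * (- q h + (expR (d h) - 1 - d h) / h) @[h --> (0 : R)^'-] --> f x * (- l + 0).
  by apply: cvgM; [exact: cvg_cst|apply: cvgD => //; exact: cvgN].
apply: cvg_trans; apply: near_eq_cvg; near=> h.
have h0 : h < 0 by near: h; exact: nbhs_left_lt.
have -> : f (x + h) = expR (- c (x + h)) by near: h.
have hq : h * q h = c (x + h) - c x by rewrite /q mulrA mulfV ?mul1r// lt_eqF.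
have -> : expR (- c (x + h)) = f x * expR (d h).
  by rewrite fx -expRD /d hq; congr expR; ring.
have -> : d h = - (h * q h) by [].
by field; exact: ltr0_neq0.
Unshelve. all: by end_near. Qed.

Lemma derivable_is_lderive (c : R -> R) x : derivable c x 1 ->
  is_lderive c x (derive1 c x).
Proof.
move=> dc; have : h^-1 *: (c (h + x) - c x) @[h --> (0 : R)^'] --> derive1 c x.
  apply: cvg_toP => //; have := dc; rewrite /derivable.
  by under eq_fun do rewrite [_ *: 1]mulr1.
move=> /cvg_dnbhs_at_left; rewrite /is_lderive.
by under eq_fun do rewrite [_ + x]addrC.
Qed.

Lemma is_lderive_lderive (c : R -> R) x l : is_lderive c x l -> lderive c x = l.
Proof. by move=> h; apply: (cvg_lim _ h); exact: Rhausdorff. Qed.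

End left_derivative_exp.

Section convex.
Context {R : realType} (D : set R) (c psi : R -> R).
Hypotheses (oD : open D) (iD : is_interval D).
Hypothesis c_convex : forall x y t, D x -> D y -> 0 <= t <= 1 ->
  c (t * x + (1 - t) * y) <= t * c x + (1 - t) * c y.

(** The three-chord inequality cleared of denominators, a form from which [lra] derives each
    comparison of slopes below. *)
Lemma convex_chord u v w : D u -> D w -> u < v -> v < w ->
  c v * (w - u) <= (w - v) * c u + (v - u) * c w.
Proof.
move=> Du Dw uv vw; have uw : 0 < w - u by lra.
pose t := (w - v) / (w - u).
have t01 : 0 <= t <= 1.
  by rewrite /t divr_ge0 ?ler_pdivrMr// ?mul1r; lra.
have tE : t * u + (1 - t) * w = v by rewrite /t; field; lra.
have := c_convex Du Dw t01; rewrite tE => h.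
have := ler_wpM2r (ltW uw) h.
rewrite (_ : (t * c u + (1 - t) * c w) * (w - u) = (w - v) * c u + (v - u) * c w)//.
by rewrite /t; field; lra.
Qed.

(** The slopes of the chords from the left increase towards [x] and are bounded by the slope to a
    point [w] on the right; their supremum is the left derivative. *)
Lemma convex_is_lderive x : D x -> exists l, is_lderive c x l.
Proof.
move=> Dx.
have Dr : exists2 w, D w & x < w.
  have : \forall y \near x^'+, D y by apply: cvg_within; exact: open_nbhs_nbhs.
  move=> Dn; near (x : R)^'+ => y; exists y; first by near: y.
  by near: y; exact: nbhs_right_gt.
have Dl : \forall y \near x^'-, D y by apply: cvg_within; exact: open_nbhs_nbhs.
have [w Dw xw] := Dr.
pose S := [set s | exists2 u, D u /\ u < x & s = (c x - c u) / (x - u)].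
have supS : has_sup S.
  split.
    near (x : R)^'- => u; exists ((c x - c u) / (x - u)); exists u => //; split; first by near: u.
    by near: u; exact: nbhs_left_lt.
  exists ((c w - c x) / (w - x)) => _ [u [Du ux] ->].
  have := convex_chord Du Dw ux xw; have xu0 : 0 < x - u by lra.
  have wx0 : 0 < w - x by lra.
  by rewrite ler_pdivrMr// mulrAC ler_pdivlMr//; lra.
exists (sup S); apply/cvgrPdist_le => e e0.
have [_ [u [Du ux] ->] hu] := sup_adherent e0 supS.
have Dlh : \forall h \near (0 : R)^'-, D (x + h).
  case: Dl => r /= r0 Hr; exists r => //= h; rewrite /ball_ /= sub0r normrN => hr h0.
  by apply: Hr; rewrite /ball_/= ?opprD ?addrA ?subrr ?sub0r ?normrN//; lra.
near=> h.
have h0 : h < 0 by near: h; exact: nbhs_left_lt.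
have uxh : u - x < h by near: h; apply: nbhs_left_gt; lra.
have Dxh : D (x + h) by near: h.
have -> : h^-1 * (c (x + h) - c x) = (c x - c (x + h)) / (x - (x + h)).
  by field; lra.
have sle : (c x - c (x + h)) / (x - (x + h)) <= sup S.
  by apply: ub_le_sup; [exact: supS.2|exists (x + h) => //; split => //; lra].
rewrite ger0_norm ?subr_ge0// lerBlDr -lerBlDl (le_trans (ltW hu))//.
have uy : u < x + h by lra.
have yx : x + h < x by lra.
have := convex_chord Du Dx uy yx.
move: (x + h) uy yx => y uy yx hc.
have xu0 : 0 < x - u by lra.
have xy0 : 0 < x - y by lra.
by rewrite ler_pdivrMr// mulrAC ler_pdivlMr//; lra.
Unshelve. all: by end_near. Qed.

Hypothesis dc : forall x, D x -> is_lderive c x (psi x).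

(** As the limit of the slopes of left chords, [psi x] is at least the slope from any y < x and at
    most the slope to any y > x. *)
Lemma convex_subgradient x y : D x -> D y -> c x + psi x * (y - x) <= c y.
Proof.
move=> Dx Dy; have [->|] := eqVneq y x; first by rewrite subrr mulr0 addr0.
rewrite neq_lt => /orP[yx|xy].
- suff : (c x - c y) / (x - y) <= psi x by rewrite ler_pdivrMr ?subr_gt0//; lra.
  apply: (cvgr_to_ge (dc Dx)); near=> h.
  have h0 : h < 0 by near: h; exact: nbhs_left_lt.
  have yxh : y - x < h by near: h; apply: nbhs_left_gt; lra.
  have -> : h^-1 * (c (x + h) - c x) = (c x - c (x + h)) / (x - (x + h)).
    by field; lra.
  have uy : y < x + h by lra.
  have zx : x + h < x by lra.
  have := convex_chord Dy Dx uy zx.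
  move: (x + h) uy zx => z uy zx hc.
  have xu0 : 0 < x - y by lra.
  have xy0 : 0 < x - z by lra.
  by rewrite ler_pdivrMr// mulrAC ler_pdivlMr//; lra.
- suff : psi x <= (c y - c x) / (y - x) by rewrite ler_pdivlMr ?subr_gt0//; lra.
  have Dl : \forall y \near x^'-, D y by apply: cvg_within; exact: open_nbhs_nbhs.
  have Dlh : \forall h \near (0 : R)^'-, D (x + h).
    case: Dl => r /= r0 Hr; exists r => //= h; rewrite /ball_ /= sub0r normrN => hr h0.
    by apply: Hr; rewrite /ball_/= ?opprD ?addrA ?subrr ?sub0r ?normrN//; lra.
  apply: (cvgr_to_le (dc Dx)); near=> h.
  have h0 : h < 0 by near: h; exact: nbhs_left_lt.
  have Dxh : D (x + h) by near: h.
  have -> : h^-1 * (c (x + h) - c x) = (c x - c (x + h)) / (x - (x + h)).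
    by field; lra.
  have zx : x + h < x by lra.
  have := convex_chord Dxh Dy zx xy.
  move: (x + h) zx => z zx hc.
  have xu0 : 0 < x - z by lra.
  have xy0 : 0 < y - x by lra.
  by rewrite ler_pdivrMr// mulrAC ler_pdivlMr//; lra.
Unshelve. all: by end_near. Qed.

(** Add the subgradient inequalities at the two points. *)
Lemma convex_lderive_nondecreasing : nondecreasing_on D psi.
Proof.
move=> x y Dx Dy; rewrite le_eqVlt => /predU1P[->//|xy].
have h1 := convex_subgradient Dx Dy; have h2 := convex_subgradient Dy Dx.
have xy0 : 0 < y - x by lra.
by rewrite -(ler_pM2r xy0); lra.
Qed.

(** Some chord from u < x to [x] has slope at least psi x - e / 2. By continuity of [c], the chord
    from [u] to a nearby y < x has slope above psi x - e, and [psi y] is at least that slope. *)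
Lemma convex_lderive_left_continuous :
  (forall x, D x -> c y @[y --> x] --> c x) -> left_continuous_on D psi.
Proof.
move=> cc x Dx; apply/cvgrPdist_le => e e0.
have e2 : 0 < e / 2 by rewrite divr_gt0.
have Dl : \forall y \near x^'-, D y by apply: cvg_within; exact: open_nbhs_nbhs.
have [u [Du ux hu]] : exists u, [/\ D u, u < x & (psi x - e / 2) * (x - u) <= c x - c u].
  near (x : R)^'- => u; exists u; split; first by near: u.
    by near: u; exact: nbhs_left_lt.
  have : `|c x - c u - psi x * (x - u)| <= e / 2 * (x - u).
    by near: u; exact: is_lderive_near (dc Dx).
  by rewrite ler_norml => /andP[+ _]; lra.
have : (c y - c u) - (psi x - e) * (y - u) @[y --> x^'-] --> (c x - c u) - (psi x - e) * (x - u).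
  apply: cvg_at_left_filter; apply: cvgB.
    by apply: cvgB; [exact: cc|exact: cvg_cst].
  by apply: cvgM; [exact: cvg_cst|apply: cvgB; [exact: cvg_id|exact: cvg_cst]].
have pos : 0 < (c x - c u) - (psi x - e) * (x - u).
  have : 0 < e / 2 * (x - u) by rewrite mulr_gt0//; lra.
  by lra.
move=> /(cvgr_gt _)/(_ _ pos) H; near=> y.
have yx : y < x by near: y; exact: nbhs_left_lt.
have uy : u < y by near: y; exact: nbhs_left_gt.
have Dy : D y by near: y.
have hy : 0 < (c y - c u) - (psi x - e) * (y - u) by near: y.
have h1 := convex_lderive_nondecreasing Dy Dx (ltW yx).
have h2 := convex_subgradient Dy Du.
rewrite ger0_norm ?subr_ge0//; have yu0 : 0 < y - u by lra.
suff : psi x - e <= psi y by lra.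
by rewrite -(ler_pM2r yu0); lra.
Unshelve. all: by end_near. Qed.

End convex.

(** * Integrability of the score of a log-concave density *)

Section log_concave_score.
Context {R : realType} (mu : probability (measurableTypeR R) R) (f : R -> R).
Hypotheses (f_ge0 : forall x, 0 <= f x) (f_cont : continuous f)
  (f_density : has_density mu f).

Let D := [set x | 0 < f x].
Hypothesis iD : is_interval D.
Variable psi : R -> R.
Hypotheses (ndpsi : nondecreasing_on D psi) (lcpsi : left_continuous_on D psi)
  (df : forall x, D x -> is_lderive f x (- (psi x * f x))).

Let measurable_psi_itv a b : D a -> D b -> a <= b ->
  measurable_fun (`]a, b]%classic : set (measurableTypeR R)) (psi : measurableTypeR R -> R).
Proof.
move=> Da Db ab; apply: (@eq_measurable_fun _ _ _ _ _ (psi \o clamp a b)).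
  move=> t; rewrite inE/= in_itv/= => /andP[at_ tb].
  by rewrite clamp_id// (ltW at_).
apply: nondecreasing_measurable => // s t st /=; apply: ndpsi.
- by apply: (iD Da Db); rewrite clamp_ge clamp_le.
- by apply: (iD Da Db); rewrite clamp_ge clamp_le.
- exact: clamp_mono.
Qed.

Let integrable_psi_itv a b : D a -> D b -> a <= b ->
  mu.-integrable `]a, b] (EFin \o psi).
Proof.
move=> Da Db ab; apply: measurable_bounded_integrable => //.
- by rewrite (le_lt_trans (probability_le1 mu _)) ?ltry.
- exact: measurable_psi_itv.
- exists (`|psi a| + `|psi b|); split; first exact: num_real.
  move=> M M1 t /=; rewrite in_itv/= => /andP[/ltW at_ tb]; rewrite (le_trans _ (ltW M1))//.
  have Dt : D t by apply: (iD Da Db); rewrite at_.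
  have := ndpsi Da Dt at_; have := ndpsi Dt Db tb.
  have := ler_norm (psi b); have := ler_norm (- psi a); rewrite normrN.
  have := normr_ge0 (psi a); have := normr_ge0 (psi b).
  by rewrite ler_norml; lra.
Qed.

Let FTC a b : D a -> D b -> a <= b ->
  f b - f a = - (\int[mu]_(t in `]a, b]) psi t)%R.
Proof.
move=> Da Db ab; apply: (left_FTC f_ge0 f_cont f_density ab).
- by move=> x /andP[/ltW ax xb]; apply: df; apply: (iD Da Db); rewrite ax.
- by move=> x /andP[/ltW ax xb]; apply: lcpsi; apply: (iD Da Db); rewrite ax.
- exact: integrable_psi_itv.
Qed.

Let mu_fine_le1 (A : set (measurableTypeR R)) : measurable A -> fine (mu A) <= 1.
Proof.
by move=> mA; rewrite -[leRHS]/(fine 1%:E) fine_le ?fin_num_measure// probability_le1.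
Qed.

(** By monotonicity psi - psi p is nonpositive before [p] and nonnegative after it, so [FTC]
    computes the integral of its modulus on each side. The bound is free of [a] and [b], which lets
    them exhaust [D]. *)
Let bound_itv a p b : D a -> D p -> D b -> a <= p -> p <= b ->
  (\int[mu]_(t in `]a, b]) `|psi t - psi p| <= 2 * (f p + `|psi p|))%R.
Proof.
move=> Da Dp Db ap pb; have ab := le_trans ap pb.
have icst (k : R) (A : set (measurableTypeR R)) : measurable A -> mu.-integrable A (EFin \o cst k).
  by move=> mA; exact: finite_measure_integrable_cst.
have iB u v : D u -> D v -> u <= v -> mu.-integrable `]u, v] (EFin \o (fun t => psi t - psi p)).
  by move=> Du Dv uv; exact: (integrableB _ (integrable_psi_itv Du Dv uv) (icst (psi p) _ _)).
have E : `]a, b]%classic = `]a, p]%classic `|` `]p, b]%classic.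
  by rewrite -itv_bndbnd_setU// bnd_simp.
rewrite E Rintegral_setU//; last 2 first.
- by rewrite -E; apply: integrable_norm; exact: iB.
- apply/disj_setPLR => t /=; rewrite !in_itv/= => /andP[_ tp].
  by apply/negP; rewrite negb_and -leNgt tp.
have RB u v : D u -> D v -> u <= v -> (\int[mu]_(t in `]u, v]) (psi t - psi p))%R =
    f u - f v - psi p * fine (mu `]u, v]%classic).
  move=> Du Dv uv; have := FTC Du Dv uv => H.
  rewrite RintegralB//; [|exact: integrable_psi_itv|exact: icst].
  by rewrite Rintegral_cst//; lra.
have -> : (\int[mu]_(t in `]a, p]) `|psi t - psi p|)%R =
    - (\int[mu]_(t in `]a, p]) (psi t - psi p))%R.
  rewrite (@eq_Rintegral _ _ _ mu _ (fun t => -1 * (psi t - psi p))).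
    by rewrite RintegralZl ?mulN1r//; exact: iB.
  move=> t; rewrite inE/= in_itv/= => /andP[at_ tp].
  rewrite mulN1r ler0_norm// subr_le0; apply: ndpsi => //.
  by apply: (iD Da Dp); rewrite (ltW at_).
have -> : (\int[mu]_(t in `]p, b]) `|psi t - psi p|)%R =
    (\int[mu]_(t in `]p, b]) (psi t - psi p))%R.
  apply: eq_Rintegral => t; rewrite inE/= in_itv/= => /andP[/ltW pt tb].
  rewrite ger0_norm// subr_ge0; apply: ndpsi => //.
  by apply: (iD Dp Db); rewrite pt.
rewrite !RB//.
have m1 u v : `|psi p * fine (mu `]u, v]%classic)| <= `|psi p|.
  by rewrite normrM ler_piMr// ger0_norm ?fine_ge0// mu_fine_le1.
have := m1 a p; have := m1 p b; rewrite !ler_norml => /andP[+ _] /andP[_ +].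
by have := f_ge0 a; have := f_ge0 b; lra.
Qed.

Lemma log_concave_score_integrable : mu.-integrable setT (EFin \o (psi \_ D)).
Proof.
have oD := positivity_open f_cont.
have mD : measurable (D : set (measurableTypeR R)) by exact: positivity_measurable.
have D0 := positivity_nonempty f_ge0 f_cont f_density.
have [p Dp] := D0.
have [n c Dc|a [nia Da ap aD]] := open_coinitial_seq (Q := fun=> [set z | z <= p]) oD D0.
  exists (Num.min c p); first by rewrite /Num.min; case: ifP => _; [exact: Dc|exact: Dp].
  by rewrite /= !ge_min !lexx !orbT.
have [n c Dc|b [ndb Db bp bD]] := open_cofinal_seq (Q := fun=> [set z | p <= z]) oD D0.
  exists (Num.max c p); first by rewrite /Num.max; case: ifP => _; [exact: Dp|exact: Dc].
  by rewrite /= !le_max !lexx !orbT.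
have lab n : a n <= b n by exact: le_trans (ap n) (bp n).
pose E n := `]a n, b n]%classic : set (measurableTypeR R).
have mE n : measurable (E n) by exact: measurable_itv.
have ED : \bigcup_n E n = D.
  apply/seteqP; split => [t [n _] /=|t Dt].
    by rewrite /E/= in_itv/= => /andP[/ltW at_ tb]; apply: (iD (Da n) (Db n)); rewrite at_.
  have [m am] := aD _ Dt; have [n bn] := bD _ Dt.
  have Et : E (maxn m n) t.
    rewrite /E/= in_itv/= (le_lt_trans (nia _ _ (leq_maxl m n)) am)/=.
    by rewrite (le_trans (ltW bn))// ndb// leq_maxr.
  by exists (maxn m n).
have mpsi : measurable_fun (D : set (measurableTypeR R)) (psi : measurableTypeR R -> R).
  rewrite -ED; apply/(measurable_fun_bigcup _ mE) => n; exact: (measurable_psi_itv (Da n) (Db n) (lab n)).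
pose g (t : measurableTypeR R) := (`|psi t - psi p|)%:E.
have mg : measurable_fun D g.
  by apply/measurable_EFinP; apply: measurableT_comp => //; exact: (measurable_funB mpsi).
have gfin : (\int[mu]_(t in D) g t < +oo)%E.
  have : (\int[mu]_(t in E n) g t)%E @[n --> \oo] --> (\int[mu]_(t in D) g t)%E.
    rewrite -ED; apply: ge0_nondecreasing_set_cvg_integral => //.
    - move=> i j ij; apply/subsetPset => t /=; rewrite /E/= !in_itv/= => /andP[at_ tb].
      by rewrite (le_lt_trans (nia _ _ ij) at_)/= (le_trans tb)// ndb.
    - by move=> n; apply: measurable_funS mg => //; rewrite -ED; exact: bigcup_sup.
    - by move=> n t _; rewrite lee_fin.
  move=> cvgE; apply: (@le_lt_trans _ _ (2 * (f p + `|psi p|))%:E); last exact: ltry.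
  rewrite -(cvg_lim (@ereal_hausdorff R) cvgE); apply: lime_le.
    by apply/cvg_ex; eexists; exact: cvgE.
  apply: nearW => n; have := bound_itv (Da n) Dp (Db n) (ap n) (bp n).
  rewrite -lee_fin /Rintegral fineK//; apply: integrable_fin_num => //.
  apply: integrable_norm.
  exact: (integrableB _ (integrable_psi_itv (Da n) (Db n) (lab n))
    (finite_measure_integrable_cst mu (psi p) _)).
have i1 : mu.-integrable D (EFin \o (fun t => psi t - psi p)).
  apply/integrableP; split; first by apply/measurable_EFinP; exact: measurable_funB.
  exact: gfin.
rewrite -restrict_EFin -integrable_mkcond//.
have := integrableD mD i1 (finite_measure_integrable_cst mu (psi p) mD).
apply: eq_integrable => // t _ /=.
by rewrite -EFinD subrK.
Qed.

End log_concave_score.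

Lemma loc_abs_cont_cvg (R : realType) (D : set R) (g : R -> R) x :
  open D -> loc_abs_cont D g -> D x -> g y @[y --> x] --> g x.
Proof.
move=> oD acg Dx; have [d /= d0 Hd] : nbhs x D by exact: open_nbhs_nbhs.
have acx : abs_cont (x - d / 2) (x + d / 2) g.
  apply: acg => t /=; rewrite in_itv/= => /andP[t1 t2]; apply: Hd.
  by rewrite /ball_/= ltr_norml; lra.
apply/cvgrPdist_lt => e e0; have [r r0 Hr] := abs_cont_modulus acx e0.
exists (Num.min r (d / 2)) => /=; first by rewrite lt_min r0/= divr_gt0.
move=> y; rewrite /ball_ /= => yx_lt.
have /andP[h1 h2] : - r < x - y < r by rewrite -ltr_norml; move: yx_lt; rewrite lt_min => /andP[].
have /andP[h3 h4] : - (d / 2) < x - y < d / 2.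
  by rewrite -ltr_norml; move: yx_lt; rewrite lt_min => /andP[].
have [xy|/ltW yx] := leP x y; first by rewrite /= distrC; apply: Hr; lra.
by apply: Hr; lra.
Qed.

(** * The density as the exponential of an extended-valued function *)

Section density_exp.
Context {R : realType} (f : R -> R) (phi : R -> \bar R).
Hypothesis f_phi : forall x, (f x)%:E = expeR (- phi x)%E.

(** The value -oo is excluded for [phi]: it would make exp(- phi) infinite, whereas [f x] is
    real. *)
Lemma exp_density_cases x :
  (phi x = +oo%E /\ f x = 0) \/
  (phi x = (fine (phi x))%:E /\ f x = expR (- fine (phi x))).
Proof.
have := f_phi x; case: (phi x) => [r|//|//] /= [] fx.
- by right.
- by left.
Qed.

Lemma exp_density_ge0 x : 0 <= f x.
Proof. by case: (exp_density_cases x) => -[_ ->]//; exact: expR_ge0. Qed.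

Lemma edom_positivity : edom phi = [set x | 0 < f x].
Proof.
apply/seteqP; split => x; rewrite /edom/=; case: (exp_density_cases x) => -[-> ->]; rewrite ?ltxx//.
  by rewrite expR_gt0.
by rewrite ltry.
Qed.

Lemma edom_fin x : edom phi x -> phi x = (fine (phi x))%:E.
Proof. by rewrite /edom/=; case: (exp_density_cases x) => -[]// -> . Qed.

Lemma edom_exp x : edom phi x -> f x = expR (- fine (phi x)).
Proof. by rewrite /edom/=; case: (exp_density_cases x) => -[]// -> . Qed.

Hypothesis f_cont : continuous f.

Lemma edom_open : open (edom phi).
Proof. by rewrite edom_positivity; exact: positivity_open. Qed.

Lemma edom_near x : edom phi x -> \forall y \near x, edom phi y.
Proof. by move=> Dx; apply: open_nbhs_nbhs; split => //; exact: edom_open. Qed.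

Lemma edom_cvg x : edom phi x -> (fine \o phi) y @[y --> x] --> (fine \o phi) x.
Proof.
move=> Dx; have fx : f y @[y --> x] --> f x by exact: f_cont.
have fx0 : 0 < f x by move: Dx; rewrite edom_positivity.
have lnE y : edom phi y -> (fine \o phi) y = - ln (f y).
  by move=> Dy; rewrite (edom_exp Dy) expRK opprK.
rewrite (lnE _ Dx).
have : - ln (f y) @[y --> x] --> - ln (f x).
  by apply: cvgN; apply: (cvg_comp _ _ fx); exact: continuous_ln.
apply: cvg_trans; apply: near_eq_cvg.
by apply: filterS (edom_near Dx) => y /lnE ->.
Qed.

Lemma edom_is_lderive x l : edom phi x ->
  is_lderive (fine \o phi) x l -> is_lderive f x (- (l * f x)).
Proof.
move=> Dx; apply: is_lderive_expN.
by apply: filterS (edom_near Dx) => y /edom_exp.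
Qed.

(* If the derivative is bounded above up to the first zero s of f after a, then
   so is phi, and f cannot tend to f s = 0. *)
Lemma edom_interval (l : R -> R) :
  (forall x, edom phi x -> is_lderive (fine \o phi) x (l x)) ->
  (forall a b, edom phi a -> edom phi b -> exists M, forall x, edom phi x ->
    a <= x <= b -> l x <= M) ->
  is_interval (edom phi).
Proof.
move=> dphi lM a b Da Db t /andP[at_ tb].
apply: contrapT => nDt; have [M HM] := lM a b Da Db.
have f0 y : ~ edom phi y -> f y = 0.
  rewrite edom_positivity /= => /negP; rewrite -leNgt => h.
  by apply/le_anti; rewrite h exp_density_ge0.
pose A := [set y | a <= y <= t /\ ~ edom phi y].
have At : A t by split => //; rewrite at_ lexx.
have infA : has_inf A by split; [exists t|exists a => y -[/andP[]]].
pose s := inf A.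
have as_ : a <= s by apply: lb_le_inf; [exists t|move=> y -[/andP[]]].
have st : s <= t by apply: ge_inf => //; exact: infA.2.
(* The domain is open and missing points accumulate at their infimum [s] or attain it, so [s] is
   missing as well. *)
have nDs : ~ edom phi s.
  move=> Ds; have [d /= d0 Hd] := edom_near Ds.
  have [y Ay ysd] := inf_adherent d0 infA.
  have sy : s <= y by apply: ge_inf => //; exact: infA.2.
  case: (Ay) => _; apply; apply: Hd => /=.
  by rewrite ler0_norm ?subr_le0// opprB ltrBlDl.
have asl : a < s.
  by rewrite lt_neqAle as_ andbT; apply/eqP => E; apply: nDs; rewrite -E.
have Dlt y : a <= y -> y < s -> edom phi y.
  move=> ay ys; apply: contrapT => nDy.
  have : s <= y by apply: ge_inf; [exact: infA.2|split => //; rewrite ay (le_trans (ltW ys))].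
  by rewrite leNgt ys.
(* On [a, s[ the mean value inequality gives phi z <= phi a + |M| (z - a); taking |M| instead of [M]
   makes the bound largest at z = s. *)
pose K := expR (- ((fine \o phi) a + `|M| * (s - a))).
have Kf z : a <= z -> z < s -> K <= f z.
  move=> az zs; rewrite (edom_exp (Dlt _ az zs)) ler_expR lerN2.
  suff : (fine \o phi) z - (fine \o phi) a <= `|M| * (z - a).
    move=> h; have : `|M| * (z - a) <= `|M| * (s - a) by rewrite ler_wpM2l// lerB// ltW.
    by move: h => /=; lra.
  apply: left_mean_value => //.
  - move=> x /andP[ax xz]; apply: cvg_at_right_filter; apply: edom_cvg.
    by apply: Dlt => //; exact: lt_trans zs.
  - move=> x e /andP[ax xz] e0.
    have Dx : edom phi x by apply: Dlt; [exact: ltW|exact: le_lt_trans zs].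
    have lx : l x <= M.
      apply: HM => //; rewrite (ltW ax)/= (le_trans xz)// (le_trans (ltW zs))//.
      exact: le_trans tb.
    near=> y; have yx : y < x by near: y; exact: nbhs_left_lt.
    have : `|(fine \o phi) x - (fine \o phi) y - l x * (x - y)| <= e * (x - y).
      by near: y; apply: is_lderive_near => //; exact: dphi.
    rewrite ler_norml => /andP[_ h].
    have xy0 : 0 <= x - y by lra.
    have := ler_wpM2r xy0 lx; have := ler_wpM2r xy0 (ler_norm M).
    by move: h => /=; lra.
have fs : f y @[y --> s^'-] --> f s by apply: cvg_at_left_filter; exact: f_cont.
have : K <= f s.
  apply: (cvgr_to_ge fs); near=> y; apply: Kf; last by near: y; exact: nbhs_left_lt.
  by near: y; exact: nbhs_left_ge.
by rewrite f0// leNgt expR_gt0.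
Unshelve. all: by end_near. Qed.

Hypothesis phi_convex : econvex phi.

Lemma econvex_edom : is_interval (edom phi).
Proof.
move=> x z Dx Dz y /andP[xy yz]; have [->//|xz] := eqVneq y z.
have yz' : y < z by rewrite lt_neqAle xz.
have xz0 : 0 < z - x by lra.
pose t := (z - y) / (z - x).
have t01 : 0 <= t <= 1 by rewrite /t divr_ge0 ?ler_pdivrMr// ?mul1r; lra.
have <- : t * x + (1 - t) * z = y by rewrite /t; field; lra.
apply: (le_lt_trans (phi_convex x z t01)).
by rewrite (edom_fin Dx) (edom_fin Dz) -!EFinM -EFinD ltry.
Qed.

Lemma econvex_fine x y t : edom phi x -> edom phi y -> 0 <= t <= 1 ->
  (fine \o phi) (t * x + (1 - t) * y) <=
  t * (fine \o phi) x + (1 - t) * (fine \o phi) y.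
Proof.
move=> Dx Dy t01; have := phi_convex x y t01.
have Dt : edom phi (t * x + (1 - t) * y).
  apply: (le_lt_trans (phi_convex x y t01)).
  by rewrite (edom_fin Dx) (edom_fin Dy) -!EFinM -EFinD ltry.
by rewrite {1}(edom_fin Dt) {1}(edom_fin Dx) {1}(edom_fin Dy) -!EFinM -EFinD lee_fin.
Qed.

End density_exp.

(** [centered_integral] works with a function integrable on the whole line. The restriction of [psi]
    to the open set agrees with [psi] near each of its points, so left limits are unchanged. *)
Lemma score_identity (R : realType) (mu : probability (measurableTypeR R) R) (f psi : R -> R) x :
  (forall x, 0 <= f x) -> continuous f -> has_density mu f ->
  is_interval [set x | 0 < f x] ->
  mu.-integrable setT (EFin \o (psi \_ [set x | 0 < f x])) ->
  (forall x, 0 < f x -> is_lderive f x (- (psi x * f x))) ->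
  left_continuous_on [set x | 0 < f x] psi ->
  (- \int[mu]_z (((z <= x)%R%:R - distr_fun mu x) * (psi \_ [set x | 0 < f x]) z))%R = f x.
Proof.
move=> f0 fc fd iD ipsi df lc; rewrite -[RHS]opprK; congr (- _).
apply: centered_integral => //.
- by move=> y Dy; rewrite patchE mem_set//; exact: df.
- move=> y Dy; rewrite [in X in _ --> X]patchE mem_set//.
  apply: cvg_trans (lc _ Dy); apply: near_eq_cvg.
  have : \forall z \near y^'-, 0 < f z.
    by apply: cvg_within; apply: open_nbhs_nbhs; split => //; exact: (positivity_open fc).
  by apply: filterS => z Dz; rewrite patchE mem_set.
Qed.

Lemma nondecreasing_derive1_ge0 (R : realType) (D : set R) (g : R -> R) x :
  open D -> nondecreasing_on D g -> D x -> 0 <= derive1 g x.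
Proof.
move=> oD ndg Dx; have [cg|ncg] := pselect (cvg (h^-1 *: (g (h + x) - g x) @[h --> (0 : R)^'])).
  apply: limr_ge => //.
  have [d /= d0 Hd] : nbhs x D by exact: open_nbhs_nbhs.
  exists d => //= h; rewrite /ball_ /= sub0r normrN => hd h0.
  have Dhx : D (h + x) by apply: Hd; rewrite /ball_/= opprD addrCA subrr addr0 normrN.
  have [h1|h1] := ltP 0 h.
    by rewrite mulr_ge0 ?invr_ge0 ?(ltW h1)// subr_ge0 ndg// lerDr ltW.
  rewrite -[X in X *: _]opprK scaleNr -scalerN opprB mulr_ge0//.
    by rewrite oppr_ge0 invr_le0.
  by rewrite subr_ge0 ndg// gerDr.
(* If the quotient diverges, [derive1] is the default value of the limit, which is 0. *)
by rewrite /derive1 (dvgP ncg).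
Qed.

Theorem corollary2p5 (R : realType) (mu : probability (measurableTypeR R) R)
    (f : R -> R) (phi : R -> \bar R)
    (f_phi : forall x, (f x)%:E = expeR (- phi x)%E)
    (f_ac : loc_abs_cont setT f)
    (f_density : has_density mu f) :
  (* (a) *)
  (forall phi1 phi2 : R -> R,
    (forall x, edom phi x -> is_lderive (fine \o phi) x (phi1 x - phi2 x)) ->
    mu.-integrable (edom phi) (EFin \o phi1) ->
    mu.-integrable (edom phi) (EFin \o phi2) ->
    left_continuous_on (edom phi) phi1 ->
    left_continuous_on (edom phi) phi2 ->
    nondecreasing_on (edom phi) phi1 ->
    nondecreasing_on (edom phi) phi2 ->
    forall x : R,
      (\int[stieltjes (edom phi) phi1]_y (Kmu mu x y)%:E
       - \int[stieltjes (edom phi) phi2]_y (Kmu mu x y)%:E = (f x)%:E)%E)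
  /\
  (* (b) *)
  (is_interval (edom phi) ->
    (forall x, edom phi x -> derivable (fine \o phi) x 1) ->
    mu.-integrable (edom phi) (EFin \o (derive1 (fine \o phi))) ->
    loc_abs_cont (edom phi) (derive1 (fine \o phi)) ->
    forall x : R,
      has_integral (fun y => (Kmu mu x y * derive1n 2 (fine \o phi) y)%:E) ->
      (\int[lebesgue_measure]_y (Kmu mu x y * derive1n 2 (fine \o phi) y)%:E
       = (f x)%:E)%E)
  /\
  (* (c) *)
  (econvex phi ->
    forall x : R,
      (\int[stieltjes (edom phi) (lderive (fine \o phi))]_y (Kmu mu x y)%:E
       = (f x)%:E)%E)
  /\
  (* (d) *)
  (econvex phi ->
    (forall x, edom phi x -> derivable (fine \o phi) x 1) ->
    loc_abs_cont (edom phi) (derive1 (fine \o phi)) ->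
    forall x : R,
      (\int[lebesgue_measure]_y (Kmu mu x y * derive1n 2 (fine \o phi) y)%:E
       = (f x)%:E)%E).
Proof.
have f0 : forall x, 0 <= f x by exact: exp_density_ge0 f_phi.
have fc : continuous f.
  by move=> x; apply: (@loc_abs_cont_cvg _ setT) => //; exact: openT.
have DE := edom_positivity f_phi; have oD := edom_open f_phi fc.
have mD : measurable (edom phi : set (measurableTypeR R)) by exact: open_measurable.
have D0 : edom phi !=set0.
  by rewrite DE; exact: positivity_nonempty f0 fc f_density.
have muD : mu (~` edom phi) = 0%E by rewrite DE; exact: density_off_positivity f0 fc f_density.
have dfD x l := @edom_is_lderive _ _ _ f_phi fc x l.
have iT (g : R -> R) : mu.-integrable (edom phi) (EFin \o g) ->
    mu.-integrable setT (EFin \o (g \_ (edom phi))).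
  by move=> ig; rewrite -restrict_EFin -integrable_mkcond.
have partb : is_interval (edom phi) ->
    (forall x, edom phi x -> derivable (fine \o phi) x 1) ->
    mu.-integrable setT (EFin \o (derive1 (fine \o phi) \_ (edom phi))) ->
    loc_abs_cont (edom phi) (derive1 (fine \o phi)) ->
    forall x : R,
      has_integral (fun y => (Kmu mu x y * derive1n 2 (fine \o phi) y)%:E) ->
      (\int[lebesgue_measure]_y (Kmu mu x y * derive1n 2 (fine \o phi) y)%:E
       = (f x)%:E)%E.
  move=> iD dphi iphi' acphi' x hi.
  have lc : left_continuous_on (edom phi) (derive1 (fine \o phi)).
    by move=> y Dy; apply: cvg_at_left_filter; exact: loc_abs_cont_cvg oD acphi' Dy.
  have dfx y : edom phi y -> is_lderive f y (- (derive1 (fine \o phi) y * f y)).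
    by move=> Dy; apply: dfD => //; exact: derivable_is_lderive (dphi _ Dy).
  rewrite DE in iD iphi' acphi' lc dfx.
  rewrite (density_covariance f0 fc f_density iD iphi' acphi' hi).
  by rewrite (score_identity x f0 fc f_density iD iphi' dfx lc).
have convexP psi : econvex phi -> (forall x, edom phi x -> is_lderive (fine \o phi) x (psi x)) ->
    [/\ nondecreasing_on (edom phi) psi, left_continuous_on (edom phi) psi &
    mu.-integrable setT (EFin \o (psi \_ (edom phi)))].
  move=> cphi dpsi; have iD := econvex_edom f_phi cphi.
  have cfine := econvex_fine f_phi cphi.
  have nd : nondecreasing_on (edom phi) psi.
    exact: (convex_lderive_nondecreasing oD cfine dpsi).
  have lc : left_continuous_on (edom phi) psi.
    apply: (convex_lderive_left_continuous oD cfine dpsi).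
    by move=> x Dx; exact: edom_cvg f_phi fc _ Dx.
  have dfx y : edom phi y -> is_lderive f y (- (psi y * f y)).
    by move=> Dy; apply: dfD => //; exact: dpsi.
  split => //; rewrite DE in iD nd lc dfx *.
  exact: log_concave_score_integrable.
split; [|split; [|split]].
- move=> phi1 phi2 dphi i1 i2 lc1 lc2 nd1 nd2 x.
  have iD : is_interval (edom phi).
    apply: (edom_interval f_phi fc dphi) => a b Da Db.
    (* Monotonicity of both parts bounds the left derivative from above between [a] and [b], as
       [edom_interval] asks. *)
    exists (phi1 b - phi2 a) => y Dy /andP[ay yb].
    by rewrite lerB//; [exact: nd1|exact: nd2].
  have stE g : left_continuous_on (edom phi) g -> nondecreasing_on (edom phi) g ->
      mu.-integrable (edom phi) (EFin \o g) ->
      (\int[stieltjes (edom phi) g]_y (Kmu mu x y)%:E =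
       (- \int[mu]_z (((z <= x)%R%:R - distr_fun mu x) * (g \_ (edom phi)) z))%R%:E)%E.
    by move=> lcg ndg ig; apply: stieltjes_covariance => //; exact: stieltjesP.
  rewrite !stE// -EFinB opprK; congr EFin.
  pose g z := phi1 z - phi2 z.
  have gE z : (g \_ (edom phi)) z = (phi1 \_ (edom phi)) z - (phi2 \_ (edom phi)) z.
    by rewrite !patchE; case: ifP => _; rewrite ?subrr.
  have ig : mu.-integrable setT (EFin \o (g \_ (edom phi))).
    by apply: iT; exact: (integrableB mD i1 i2).
  have lc : left_continuous_on (edom phi) g.
    by move=> y Dy; apply: cvgB; [exact: lc1|exact: lc2].
  have dfx y : edom phi y -> is_lderive f y (- (g y * f y)).
    by move=> Dy; apply: dfD => //; exact: dphi.
  have ic1 := integrable_centeredM x (iT _ i1); have ic2 := integrable_centeredM x (iT _ i2).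
  have -> : f x = (- \int[mu]_z (((z <= x)%R%:R - distr_fun mu x) * (g \_ (edom phi)) z))%R.
    by rewrite DE in iD ig lc dfx *; rewrite (score_identity x f0 fc f_density iD ig dfx lc).
  under [in RHS]eq_Rintegral do rewrite gE mulrBr.
  by rewrite RintegralB// opprB addrC.
- by move=> iD dphi iphi' acphi' x; apply: partb => //; exact: iT.
- move=> cphi x; have iD := econvex_edom f_phi cphi.
  have cfine := econvex_fine f_phi cphi.
  have dpsi y : edom phi y -> is_lderive (fine \o phi) y (lderive (fine \o phi) y).
    move=> Dy; have [l dl] := convex_is_lderive oD cfine Dy.
    by rewrite (is_lderive_lderive dl).
  have [nd lc ipsi] := convexP _ cphi dpsi.
  rewrite (@stieltjes_covariance R mu (edom phi) (lderive (fine \o phi)))//; last 2 first.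
  + exact: stieltjesP.
  + by rewrite integrable_mkcond// restrict_EFin.
  have dfx y : edom phi y -> is_lderive f y (- (lderive (fine \o phi) y * f y)).
    by move=> Dy; apply: dfD => //; exact: dpsi.
  rewrite DE in iD ipsi lc dfx *.
  by rewrite (score_identity x f0 fc f_density iD ipsi dfx lc).
- move=> cphi dphi acphi' x.
  have [nd lc ipsi] := convexP _ cphi (fun y Dy => derivable_is_lderive (dphi y Dy)).
  have iD := econvex_edom f_phi cphi.
  (* The integral is well defined because the integrand is nonnegative, the derivative being
     monotone on the domain and the kernel zero outside it. *)
  apply: partb => //; right.
  rewrite integral0_eq ?ltry// => y _; rewrite funenegE max_r// oppe_le0 lee_fin.
  have [Dy|nDy] := pselect (edom phi y).
    by rewrite mulr_ge0 ?Kmu_ge0//; exact: nondecreasing_derive1_ge0 oD nd Dy.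
  rewrite DE in iD nDy.
  by rewrite (Kmu_off_positivity f0 fc f_density iD)// mul0r.
Qed.
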